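(* Let $\mathscr R(\lambda,\phi,\psi)$ be the deterministic equivalent of the out-of-distribution risk of the full-ensemble ridge estimator, as defined in the context, let $\lambda^*\in\arg\min_{\lambda\ge\lambda_{\min}(\phi)}\mathscr R(\lambda,\phi,\phi)$, and let $$\mathscr R^{**}:=\min_{\psi\ge\phi,\ \lambda\ge\lambda_{\min}(\phi)}\mathscr R(\lambda,\phi,\psi).$$ (1) (Underparameterized) When $\phi<1$ and $\beta_0=\beta$, we have $\lambda^*\ge0$ and $$\mathscr R^{**}=\min_{\lambda\ge0}\mathscr R(\lambda,\phi,\phi)=\min_{\psi\ge\phi}\mathscr R(0,\phi,\psi).$$ (2) (Overparameterized) When $\phi\ge1$, we have $\lambda^*\ge\lambda_{\min}(\phi)$ and $$\mathscr R^{**}=\min_{\lambda\ge\lambda_{\min}(\phi)}\mathscr R(\lambda,\phi,\phi)=\min_{\psi\ge\phi}\mathscr R(\lambda_{\min}(\phi),\phi,\psi).$$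
   Context: Notation: $\overline{\mathrm{tr}}[A]=\mathrm{tr}[A]/p$ for $A\in\mathbb R^{p\times p}$. Parameters: $\Sigma,\Sigma_0\in\mathbb R^{p\times p}$ are deterministic symmetric matrices with eigenvalues bounded away from $0$ and $+\infty$ (uniformly in $p$), the train and test feature covariances; $\beta,\beta_0\in\mathbb R^p$ are the $L_2$ linear projection coefficients of the train and test responses on the features; $\sigma^2,\sigma_0^2\ge0$ are the corresponding noise variances; $\phi\in(0,\infty)$ is the limit of $p/n$ ($n$ = sample size) and $\psi\in[\phi,\infty]$ the limit of $p/k$ ($k$ = subsample size). Let $r_{\min}$ be the smallest eigenvalue of $\Sigma$. For $\psi\in(0,\infty)$ let $\mu_{\min}(\psi)>-r_{\min}$ be the unique solution of $1=\psi\,\overline{\mathrm{tr}}[\Sigma^2(\Sigma+\mu_{\min}I)^{-2}]$, and let $\lambda_{\min}(\psi)=\mu_{\min}-\psi\,\overline{\mathrm{tr}}[\mu_{\min}\Sigma(\Sigma+\mu_{\min}I)^{-1}]$. For $\lambda>\lambda_{\min}(\psi)$ let $\mu=\mu(\lambda,\psi)$ be the unique solution with $\mu>\mu_{\min}(\psi)$ of $\mu=\lambda+\psi\,\overline{\mathrm{tr}}[\mu\Sigma(\Sigma+\mu I)^{-1}]$. With $\mu=\mu(\lambda,\psi)$ put $$\tilde v(\lambda,\phi,\psi)=\frac{\phi\,\overline{\mathrm{tr}}[\Sigma_0\Sigma(\Sigma+\mu I)^{-2}]}{1-\phi\,\overline{\mathrm{tr}}[\Sigma^2(\Sigma+\mu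 I)^{-2}]}$$ and $$\mathscr R(\lambda,\phi,\psi)=\mu^2\beta^\top(\Sigma+\mu I)^{-1}(\tilde v\Sigma+\Sigma_0)(\Sigma+\mu I)^{-1}\beta+\sigma^2\tilde v+2\mu\,\beta^\top(\Sigma+\mu I)^{-1}\Sigma_0(\beta_0-\beta)+(\beta_0-\beta)^\top\Sigma_0(\beta_0-\beta)+\sigma_0^2.$$ All minimizations are over the extended reals, values at $\lambda=\lambda_{\min}(\psi)$, $\lambda=+\infty$ and $\psi=+\infty$ being understood as limits (possibly $+\infty$; $\psi=+\infty$ or $\lambda=+\infty$ corresponds to $\mu=+\infty$). The minimum defining $\mathscr R^{**}$ is over those pairs $(\lambda,\psi)$ for which $\mathscr R(\lambda,\phi,\psi)$ is defined, i.e. also $\lambda\ge\lambda_{\min}(\psi)$. If there are several minimizers $\lambda^*$, the assertions hold for any of them.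
   Formalization: In (1), the claim that every minimizer satisfies λ*≥0 is stated only when β≠0 or σ²≠0; if β=β₀=0 and σ²=0 the risk is constant, so every λ≥λ_min(φ), including negative ones, is a minimizer. *)

(* Defs.v *)
From mathcomp Require Import all_boot all_order all_algebra.
From mathcomp Require Import all_classical all_reals all_analysis.
Import Order.TTheory GRing.Theory Num.Theory.
Import numFieldNormedType.Exports.

Set Implicit Arguments.
Unset Strict Implicit.
Unset Printing Implicit Defensive.

Local Open Scope classical_set_scope.
Local Open Scope ring_scope.

Definition symmetric_mx (R : realType) (p : nat) (A : 'M[R]_p) : Prop :=
  A^T = A.

(* The dimension p is fixed here: bounds that are uniform in p specialize to
   these for each member of a sequence of matrices. *)
Definition eigenvalues_bounded (R : realType) (p : nat) (A : 'M[R]_p) : Prop :=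
  exists c C : R, 0 < c /\ forall a : R, eigenvalue A a -> c <= a <= C.

Definition trbar (R : realType) (p : nat) (A : 'M[R]_p) : R := \tr A / p%:R.

Definition resolvent (R : realType) (p : nat) (Sigma : 'M[R]_p) (mu : R) :
  'M[R]_p := invmx (Sigma + mu%:M).

Definition bilin (R : realType) (p : nat) (u : 'cV[R]_p) (A : 'M[R]_p)
  (v : 'cV[R]_p) : R := (u^T *m A *m v) ord0 ord0.

(* A symmetric real matrix of positive size has a nonempty finite set of
   eigenvalues, so this infimum is its smallest eigenvalue. *)
Definition r_min (R : realType) (p : nat) (Sigma : 'M[R]_p) : R :=
  inf [set a : R | eigenvalue Sigma a].

(* tr-bar of Sigma^2 (Sigma + mu I)^{-2} *)
Definition df2 (R : realType) (p : nat) (Sigma : 'M[R]_p) (mu : R) : R :=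
  trbar (Sigma *m Sigma *m resolvent Sigma mu *m resolvent Sigma mu).

(* In mu_min and mu, xget selects the unique element of the set; its default
   value 0 would only matter if the set were empty. *)
Definition mu_min (R : realType) (p : nat) (Sigma : 'M[R]_p) (psi : R) : R :=
  xget 0 [set m : R | - r_min Sigma < m /\ 1 = psi * df2 Sigma m].

Definition lambda_min (R : realType) (p : nat) (Sigma : 'M[R]_p) (psi : R) : R :=
  let m := mu_min Sigma psi in
  m - psi * trbar (m *: (Sigma *m resolvent Sigma m)).

Definition mu (R : realType) (p : nat) (Sigma : 'M[R]_p) (lambda psi : R) : R :=
  xget 0 [set m : R | mu_min Sigma psi < m /\
    m = lambda + psi * trbar (m *: (Sigma *m resolvent Sigma m))].

Definition vtilde (R : realType) (p : nat) (Sigma Sigma0 : 'M[R]_p)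
  (lambda phi psi : R) : R :=
  let G := resolvent Sigma (mu Sigma lambda psi) in
  phi * trbar (Sigma0 *m Sigma *m G *m G) /
    (1 - phi * df2 Sigma (mu Sigma lambda psi)).

(* The risk at an interior point: psi finite and lambda > lambda_min(psi). *)
Definition risk_int (R : realType) (p : nat) (Sigma Sigma0 : 'M[R]_p)
  (beta beta0 : 'cV[R]_p) (sigma2 sigma02 phi lambda psi : R) : R :=
  let m := mu Sigma lambda psi in
  let G := resolvent Sigma m in
  let v := vtilde Sigma Sigma0 lambda phi psi in
  m ^+ 2 * bilin beta (G *m (v *: Sigma + Sigma0) *m G) beta
  + sigma2 * v
  + 2 * m * bilin beta (G *m Sigma0) (beta0 - beta)
  + bilin (beta0 - beta) Sigma0 (beta0 - beta)
  + sigma02.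

(* Extension to lambda = lambda_min(psi) and lambda = +oo, at finite psi, by
   limits in the extended reals. Values at lambda < lambda_min(psi) are
   meaningless and excluded by risk_dom below. *)
Definition risk_fin (R : realType) (p : nat) (Sigma Sigma0 : 'M[R]_p)
  (beta beta0 : 'cV[R]_p) (sigma2 sigma02 phi : R) (lambda : \bar R) (psi : R) :
  \bar R :=
  let f := fun l : R =>
    (risk_int Sigma Sigma0 beta beta0 sigma2 sigma02 phi l psi)%:E in
  match lambda with
  | l%:E => if lambda_min Sigma psi < l then f l
            else lim (f l' @[l' --> (lambda_min Sigma psi)^'+])
  | +oo%E => lim (f l' @[l' --> +oo%R])
  | -oo%E => 0%E
  end.

(* Extension to psi = +oo, again as a limit. The value at psi = -oo is junk. *)
Definition risk (R : realType) (p : nat) (Sigma Sigma0 : 'M[R]_p)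
  (beta beta0 : 'cV[R]_p) (sigma2 sigma02 phi : R) (lambda psi : \bar R) :
  \bar R :=
  let f := risk_fin Sigma Sigma0 beta beta0 sigma2 sigma02 phi lambda in
  match psi with
  | s%:E => f s
  | +oo%E => lim (f s @[s --> +oo%R])
  | -oo%E => 0%E
  end.

(* lambda >= lambda_min(psi) is no constraint at psi = +oo, as
   lambda_min(psi) tends to -oo when psi tends to +oo. *)
Definition risk_dom (R : realType) (p : nat) (Sigma : 'M[R]_p)
  (lambda psi : \bar R) : Prop :=
  forall s : R, psi = s%:E -> ((lambda_min Sigma s)%:E <= lambda)%E.

(* x is the minimum of A, in particular it is attained. *)
Definition is_min (R : realType) (A : set (\bar R)) (x : \bar R) : Prop :=
  A x /\ lbound A x.

Definition is_argmin (R : realType) (T : Type) (f : T -> \bar R) (D : set T)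
  (t : T) : Prop := D t /\ forall t', D t' -> (f t <= f t')%E.

(* Main.v *)
(* The risk depends on (lambda, psi) only through mu: it is F(mu), for a function
   F that is continuous on (a, +oo), where a = mu_min(phi), and has limits at both
   ends, so that F attains a minimum on [a, +oo].  For psi >= phi one has
   mu >= mu_min(psi) >= a, hence no admissible value is below this minimum.

   At psi = phi the map mu |-> lambda = mu (1 - psi trbar[Sigma (Sigma + mu)^-1])
   is an increasing bijection from (a, +oo) to (lambda_min(phi), +oo), so varying
   lambda alone already reaches the minimum.  Conversely, for fixed lambda a
   prescribed mu is reached at
   psi = (mu - lambda) / (mu trbar[Sigma (Sigma + mu)^-1]).  If phi >= 1, then
   a >= 0 and lambda = lambda_min(phi) gives all mu >= a.  If phi < 1, then a < 0
   and lambda = 0 gives all mu >= 0; for beta0 = beta the values mu < 0 are not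
   better than mu = 0, because the bias vanishes at mu = 0 and vtilde decreases.

   Monotonicity in mu uses no derivative: the divided difference of
   mu trbar[Sigma (Sigma + mu)^-1] between x and y is
   trbar[Sigma^2 (Sigma + x)^-1 (Sigma + y)^-1], which lies between the values of
   trbar[Sigma^2 (Sigma + mu)^-2] at y and x. *)
Require Import Defs.
From mathcomp Require Import all_boot all_order all_algebra.
From mathcomp Require Import all_classical all_reals all_analysis.
From mathcomp Require Import complex ring lra.
Import Order.TTheory GRing.Theory Num.Theory.
Import numFieldNormedType.Exports.

Set Implicit Arguments.
Unset Strict Implicit.
Unset Printing Implicit Defensive.

Local Open Scope classical_set_scope.
Local Open Scope ring_scope.

(** * The spectral theorem for real symmetric matrices *)

Lemma row_normsq_eq0 (R : realDomainType) n (v : 'rV[R]_n) :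
  v *m v^T = 0 -> v = 0.
Proof.
move=> /matrixP/(_ 0 0); rewrite !mxE => /eqP.
under eq_bigr do rewrite mxE -expr2.
rewrite psumr_eq0 => [/allP h|i _]; last exact: sqr_ge0.
apply/rowP => j; rewrite mxE; apply/eqP.
by have := h j (mem_index_enum j); rewrite sqrf_eq0.
Qed.

(** Over the complex numbers [A] is Hermitian, so its spectral values are real. Such a value is a
    root of the characteristic polynomial, and this property descends to [R], where it yields a real
    eigenvector to normalize. *)
Lemma symmetric_eigenvector (R : rcfType) n (A : 'M[R]_n.+1) :
  A^T = A -> exists (a : R) (v : 'rV_n.+1), v *m A = a *: v /\ v *m v^T = 1%:M.
Proof.
move=> Asym.
pose AC := map_mx (real_complex R) A.
have ACherm : AC \is hermsymmx.
  apply/is_hermitianmxP; rewrite expr0 scale1r; apply/matrixP => i j.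
  rewrite !mxE -[in LHS]Asym mxE; apply/esym/CrealP/complex_realP.
  by exists (A j i).
have [a az] : exists a : R, spectral_diag AC 0 0 = real_complex R a.
  apply/complex_realP; have /mxOverP := hermitian_spectral_diag_real ACherm.
  exact.
have PAC : spectralmx AC *m AC = diag_mx (spectral_diag AC) *m spectralmx AC.
  have /hermitian_normalmx/orthomx_spectralP h := ACherm.
  by rewrite {2}h !mulmxA mulmxV ?spectral_unit // mul1mx.
have PN0 : row 0 (spectralmx AC) != 0.
  apply/negP => /eqP P0; have := spectral_unit AC.
  have: row_free (spectralmx AC) by rewrite row_free_unit spectral_unit.
  by move/row_freeP => [B /(congr1 (row 0))]; rewrite row_mul P0 mul0mx row1
    => /matrixP/(_ 0 0); rewrite !mxE => /esym/eqP; rewrite oner_eq0.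
have : eigenvalue A a.
  rewrite eigenvalue_root_char.
  rewrite -(fmorph_root (real_complex R)) map_char_poly -eigenvalue_root_char.
  apply/eigenvalueP; exists (row 0 (spectralmx AC)) => //.
  by rewrite -row_mul PAC row_mul row_diag_mx -scalemxAl -rowE az.
case/eigenvalueP => v vA vN0.
pose c := (v *m v^T) 0 0.
have c0 : 0 < c.
  rewrite lt_def; apply/andP; split.
    apply: contra vN0 => /eqP c0; apply/eqP/row_normsq_eq0.
    by apply/matrixP => i j; rewrite !ord1 [RHS]mxE.
  by rewrite /c mxE sumr_ge0 // => i _; rewrite mxE -expr2 sqr_ge0.
exists a, ((Num.sqrt c)^-1 *: v); split.
  by rewrite -scalemxAl vA !scalerA mulrC.
rewrite linearZ /= -scalemxAl -scalemxAr scalerA -invfM -expr2 sqr_sqrtr ?ltW//.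
by rewrite [v *m v^T]mx11_scalar -/c scale_scalar_mx mulVf // gt_eqF.
Qed.

Lemma orthogonal_first_row (R : realFieldType) n (v : 'rV[R]_n.+1) :
  v *m v^T = 1%:M -> exists Q : 'M[R]_n.+1, Q *m Q^T = 1%:M /\ row 0 Q = v.
Proof.
move=> vv; pose e : 'rV[R]_n.+1 := delta_mx 0 0.
have ee : e *m e^T = 1%:M.
  by rewrite trmx_delta mul_delta_mx; apply/matrixP => i j; rewrite !ord1 !mxE.
have [->|vNe] := eqVneq v e.
  by exists 1%:M; rewrite trmx1 mulmx1; split=> //; rewrite row1.
(* Householder reflection exchanging [e] and [v]. *)
pose w := v - e; pose c := (w *m w^T) 0 0.
have wwc : w *m w^T = c%:M by rewrite [LHS]mx11_scalar.
have c0 : c != 0.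
  apply: contra vNe => /eqP c0; rewrite -subr_eq0; apply/eqP/row_normsq_eq0.
  by rewrite -/w wwc c0; apply/matrixP => i j; rewrite !mxE mul0rn.
(* Since [e] and [v] are unit vectors, [c = 2 - 2 (e *m v^T) = -2 (e *m w^T)]; hence the reflection
   sends [e] to [e + w = v]. *)
have ewc : e *m w^T = (- (c / 2))%:M.
  have ev : e *m v^T = v *m e^T.
    rewrite [LHS]mx11_scalar [RHS]mx11_scalar -[v *m e^T]trmxK trmx_mul trmxK.
    by rewrite [in RHS]mxE.
  have : w *m w^T = (-2) *: (e *m w^T).
    rewrite /w linearB /= mulmxBl !mulmxBr vv ee ev.
    by apply/matrixP => i j; rewrite !mxE; ring.
  rewrite wwc => /(congr1 (fun M => (-2)^-1 *: M)).
  rewrite scalerA mulVf ?scale1r ?oppr_eq0 ?pnatr_eq0// => <-.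
  by apply/matrixP => i j; rewrite !mxE !ord1 /= !mulr1n; field.
pose S := w^T *m w.
have ST : S^T = S by rewrite trmx_mul trmxK.
have SS : S *m S = c *: S.
  by rewrite mulmxA -[w^T *m w *m w^T]mulmxA wwc mul_mx_scalar -scalemxAl.
exists (1%:M - (2 / c) *: S); split.
  have -> : (1%:M - (2 / c) *: S)^T = 1%:M - (2 / c) *: S.
    by apply/matrixP => i j; rewrite -[in RHS]ST !mxE eq_sym.
  rewrite mulmxBl mul1mx mulmxBr mulmx1 -scalemxAl -scalemxAr SS !scalerA.
  by apply/matrixP => i j; rewrite !mxE; field.
rewrite rowE -/e mulmxBr mulmx1 -scalemxAr mulmxA ewc mul_scalar_mx scalerA.
by apply/matrixP => i j; rewrite !mxE; field.
Qed.

(** Deflation: a unit eigenvector is completed to an orthogonal [Q]. In this basis the first row of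
    [A] is [a] times the first unit vector, so by symmetry the matrix is block diagonal, and
    induction applies to the lower right block. *)
Theorem spectral_theorem_real (R : rcfType) n (A : 'M[R]_n) : A^T = A ->
  exists (P : 'M[R]_n) (d : 'rV[R]_n),
    P *m P^T = 1%:M /\ A = P^T *m diag_mx d *m P.
Proof.
elim: n A => [|n IH] A Asym.
  by exists 1%:M, 0; rewrite !(flatmx0 _, thinmx0); split.
have [a [v [vA vv]]] := symmetric_eigenvector Asym.
have [Q [QQ Q0]] := orthogonal_first_row vv.
have QQ' : Q^T *m Q = 1%:M by apply: mulmx1C.
have [B Bdef] : exists B : 'M[R]_(1 + n), B = Q *m A *m Q^T by eexists.
have Bsym : B^T = B by rewrite Bdef !trmx_mul trmxK Asym mulmxA.
have B0 : row 0 B = a *: delta_mx 0 0.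
  by rewrite Bdef !row_mul Q0 vA -scalemxAl -[v]Q0 -row_mul QQ row1.
have Bur : ursubmx B = 0.
  apply/matrixP => i j; rewrite !ord1 !mxE.
  move/rowP: B0 => /(_ (rshift 1 j)); rewrite !mxE /= mulr0 => <-.
  by congr (B _ _); apply/val_inj.
have Bul : ulsubmx B = a%:M.
  apply/matrixP => i j; rewrite !ord1 !mxE.
  move/rowP: B0 => /(_ (lshift n 0)); rewrite !mxE /= mulr1 => <-.
  by congr (B _ _); apply/val_inj.
have Bdl : dlsubmx B = 0 by rewrite -[B]Bsym -trmx_ursub Bur trmx0.
have Bdr : (drsubmx B)^T = drsubmx B by rewrite trmx_drsub Bsym.
have [P [d [PP drE]]] := IH _ Bdr.
have BE : B = block_mx a%:M 0 0 (drsubmx B).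
  by rewrite -[LHS]submxK Bur Bul Bdl.
have [P1 P1E] : exists P1 : 'M[R]_(1 + n), P1 = block_mx 1%:M 0 0 P by eexists.
have P1T : P1^T = block_mx 1%:M 0 0 P^T by rewrite P1E tr_block_mx !trmx0 trmx1.
have P1P1 : P1 *m P1^T = 1%:M.
  rewrite P1T P1E mulmx_block.
  by rewrite !(mulmx0, mul0mx, mulmx1, addr0, add0r) PP -scalar_mx_block.
have P1B : B = P1^T *m diag_mx (row_mx a%:M d) *m P1.
  rewrite BE diag_mx_row P1T P1E !mulmx_block.
  rewrite !(mulmx0, mul0mx, mulmx1, mul1mx, addr0, add0r) -drE.
  by congr block_mx; apply/matrixP => i j; rewrite !ord1 !mxE.
exists (P1 *m Q), (row_mx a%:M d); split.
  by rewrite trmx_mul mulmxA -[P1 *m Q *m _]mulmxA QQ mulmx1 P1P1.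
have -> : A = Q^T *m B *m Q by rewrite Bdef !mulmxA QQ' mul1mx -mulmxA QQ' mulmx1.
by rewrite P1B trmx_mul !mulmxA.
Qed.

(** * Functional calculus in an orthonormal eigenbasis *)

Definition spectral_fun (R : fieldType) (p : nat) (P : 'M[R]_p) (d : 'rV[R]_p)
  (f : R -> R) : 'M[R]_p := P^T *m diag_mx (map_mx f d) *m P.

Section SpectralFunctions.
Variables (R : fieldType) (p : nat) (P : 'M[R]_p) (d : 'rV[R]_p).
Hypothesis PP : P *m P^T = 1%:M.

Local Notation sf := (spectral_fun P d).

Lemma spectral_funM f g : sf f *m sf g = sf (fun x => f x * g x).
Proof.
rewrite /spectral_fun !mulmxA -(mulmxA (P^T *m _)) PP mulmx1 -(mulmxA P^T).
congr (_ *m _ *m _); rewrite mulmx_diag; congr diag_mx.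
by apply/rowP => i; rewrite !mxE.
Qed.

Lemma spectral_fun1 : sf (fun=> 1) = 1%:M.
Proof.
rewrite /spectral_fun [map_mx _ _](_ : _ = const_mx 1) ?diag_const_mx ?mulmx1.
  exact: mulmx1C.
by apply/rowP => i; rewrite !mxE.
Qed.

Lemma spectral_fun_affine c : sf id + c%:M = sf (+%R^~ c).
Proof.
have -> : c%:M = sf (fun=> c).
  rewrite /spectral_fun [map_mx _ _](_ : _ = const_mx c); last first.
    by apply/rowP => i; rewrite !mxE.
  by rewrite diag_const_mx mul_mx_scalar -scalemxAl mulmx1C // scalemx1.
rewrite /spectral_fun -mulmxDl -mulmxDr -linearD /=.
by congr (_ *m diag_mx _ *m _); apply/rowP => i; rewrite !mxE.
Qed.

Lemma spectral_fun_inv c : (forall i, d 0 i + c != 0) ->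
  invmx (sf id + c%:M) = sf (fun x => (x + c)^-1).
Proof.
move=> dc.
have h : (sf id + c%:M) *m sf (fun x => (x + c)^-1) = 1%:M.
  rewrite spectral_fun_affine spectral_funM -spectral_fun1.
  rewrite /spectral_fun; congr (_ *m diag_mx _ *m _).
  by apply/rowP => i; rewrite !mxE mulfV.
have [u _] := mulmx1_unit h.
by rewrite -[LHS]mulmx1 -h mulKmx.
Qed.

Lemma mxtrace_spectral_fun f M :
  \tr (M *m sf f) = \sum_i (P *m M *m P^T) i i * f (d 0 i).
Proof.
rewrite /spectral_fun !mulmxA mxtrace_mulC !mulmxA mul_mx_diag.
by apply: eq_bigr => i _; rewrite !mxE.
Qed.

Lemma mxtrace_spectral_fun1 f : \tr (sf f) = \sum_i f (d 0 i).
Proof.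
rewrite -[sf f]mul1mx mxtrace_spectral_fun mulmx1 PP.
by apply: eq_bigr => i _; rewrite mxE eqxx mul1r.
Qed.

Lemma spectral_fun_apply f (u : 'cV_p) i :
  (P *m (sf f *m u)) i 0 = f (d 0 i) * (P *m u) i 0.
Proof.
by rewrite /spectral_fun !mulmxA PP mul1mx -mulmxA mul_diag_mx !mxE.
Qed.

(** An eigenvector has a nonzero coordinate in the basis of rows of [P], and [A] multiplies that
    coordinate by [d 0 i]. Conversely each row of [P] is a nonzero eigenvector. *)
Lemma eigenvalue_spectral a : eigenvalue (sf id) a = [exists i, d 0 i == a].
Proof.
have PP' : P^T *m P = 1%:M by apply: mulmx1C.
have PA : P *m sf id = diag_mx d *m P.
  rewrite /spectral_fun !mulmxA PP mul1mx; congr (diag_mx _ *m _).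
  by apply/rowP => i; rewrite !mxE.
apply/eigenvalueP/existsP => [[v vA vN0]|[i /eqP <-]].
  have [i vi] : exists i, (v *m P^T) 0 i != 0.
    apply/existsP; apply: contraNT vN0; rewrite negb_exists => /forallP h.
    rewrite -[v]mulmx1 -PP' mulmxA [v *m _](_ : _ = 0) ?mul0mx //.
    by apply/rowP => i; rewrite [RHS]mxE; apply/eqP; have := h i; rewrite negbK.
  exists i; apply/eqP/(mulIf vi).
  have : v *m P^T *m diag_mx d = a *: (v *m P^T).
    rewrite scalemxAl -vA -[in LHS](map_mx_id (f := id) _ d) // /spectral_fun.
    by rewrite !mulmxA -(mulmxA _ P) PP mulmx1.
  by move/rowP/(_ i); rewrite mul_mx_diag !mxE mulrC.
exists (row i P).
  by rewrite -row_mul PA row_mul row_diag_mx -scalemxAl -rowE.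
apply/negP => /eqP P0; have /matrixP/(_ i i) := PP.
have -> : P *m P^T = \matrix_(j, k) (row j P *m col k P^T) 0 0.
  by apply/matrixP => j k; rewrite !mxE; apply: eq_bigr => l _; rewrite !mxE.
by rewrite mxE P0 mul0mx !mxE eqxx => /esym/eqP; rewrite oner_eq0.
Qed.

End SpectralFunctions.

Lemma spectral_decomposition (R : realType) p (A : 'M[R]_p) :
  symmetric_mx A -> exists P d, P *m P^T = 1%:M /\ A = spectral_fun P d id.
Proof.
move=> /spectral_theorem_real[P [d [PP AE]]]; exists P, d; split => //.
by rewrite {1}AE /spectral_fun map_mx_id.
Qed.

Lemma bilin_spectral_fun (R : realType) p (P : 'M[R]_p) (d : 'rV[R]_p) f u v :
  P *m P^T = 1%:M ->
  bilin u (spectral_fun P d f) v =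
    \sum_i f (d 0 i) * (P *m u) i 0 * (P *m v) i 0.
Proof.
move=> PP; rewrite /bilin /spectral_fun.
rewrite !mulmxA -trmx_mul -mulmxA mul_mx_diag mxE.
by apply: eq_bigr => i _; rewrite !mxE /=; ring.
Qed.

(** In the eigenbasis the form is a sum of squares with positive weights [d 0 i], and [P] is
    injective. *)
Lemma bilin_gt0 (R : realType) p (A : 'M[R]_p) (u : 'cV[R]_p) :
  symmetric_mx A -> eigenvalues_bounded A -> u != 0 -> 0 < bilin u A u.
Proof.
move=> /spectral_decomposition[P [d [PP ->]]] [c [C [c0 ev]]] uN0.
rewrite bilin_spectral_fun //.
have dpos i : 0 < d 0 i.
  have /ev/andP[ci _] : eigenvalue (spectral_fun P d id) (d 0 i).
    by rewrite eigenvalue_spectral //; apply/existsP; exists i.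
  exact: lt_le_trans c0 ci.
have t0 i : 0 <= id (d 0 i) * (P *m u) i 0 * (P *m u) i 0.
  by rewrite -mulrA -expr2 mulr_ge0 ?sqr_ge0 // ltW.
rewrite lt_def sumr_ge0 // andbT; apply: contra uN0.
rewrite psumr_eq0 // => /allP h.
have Pu : P *m u = 0.
  apply/colP => i; have := h i (mem_index_enum i).
  by rewrite !mulf_eq0 (gt_eqF (dpos i)) /= orbb [RHS]mxE => /eqP.
by rewrite -[u]mul1mx -(mulmx1C PP) -mulmxA Pu mulmx0.
Qed.

Lemma cvg_finsum (R : realType) (T : Type) (F : set_system T) {FF : Filter F}
    (I : finType) (f : I -> T -> R) (l : I -> R) :
  (forall i, f i x @[x --> F] --> l i) ->
  \sum_i f i x @[x --> F] --> \sum_i l i.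
Proof.
move=> h; elim: (index_enum I) => [|i r IH].
  by under eq_fun do rewrite big_nil; rewrite big_nil; apply: cvg_cst.
under eq_fun do rewrite big_cons.
by rewrite big_cons; apply: cvgD.
Qed.

(** * Trace functionals of the resolvent *)

Section Companion.
Variables (R : realType) (p : nat) (s : 'I_p -> R) (r : R).
Hypotheses (r0 : 0 < r) (rs : forall i, r <= s i) (sr : exists i, s i = r).

Let p0 : 0 < p%:R :> R.
Proof. by have [[i ip] _] := sr; rewrite ltr0n; apply: leq_ltn_trans ip. Qed.

Let s0 i : 0 < s i. Proof. exact: lt_le_trans r0 (rs i). Qed.

Lemma shift_gt0 i m : - r < m -> 0 < s i + m.
Proof. by have := rs i; lra. Qed.

Let sm0 i m : - r < m -> s i + m != 0.
Proof. by move=> /(shift_gt0 i)/gt_eqF ->. Qed.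

(** For [s] the eigenvalues of [Sigma], [dof1] and [dof2] are tr-bar of [Sigma (Sigma + m)^-1] and
    of its square, the degrees of freedom of ridge regression. *)
Definition dof1 (m : R) : R := (\sum_i s i / (s i + m)) / p%:R.

Definition dof2 (m : R) : R := (\sum_i (s i / (s i + m)) ^+ 2) / p%:R.

(** The fixed-point equation for [mu], solved for [lambda]. *)
Definition lam (psi m : R) : R := m - psi * (m * dof1 m).

(* The divided difference of [m * dof1 m]; it is [dof2] on the diagonal. *)
Let chord (x y : R) : R := (\sum_i s i / (s i + x) * (s i / (s i + y))) / p%:R.

Lemma sum_lt_average (f g : 'I_p -> R) :
  (forall i, f i < g i) -> (\sum_i f i) / p%:R < (\sum_i g i) / p%:R.
Proof.
move=> fg; rewrite ltr_pM2r ?invr_gt0 //; apply: ltr_sum => // .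
by have [i _] := sr; apply/hasP; exists i; rewrite // mem_index_enum.
Qed.

Lemma ratio_lt i x y : - r < x -> x < y -> s i / (s i + y) < s i / (s i + x).
Proof.
move=> rx xy; have ry := lt_trans rx xy.
by rewrite ltr_pM2l // ltf_pV2 ?posrE ?shift_gt0 // ltrD2l.
Qed.

Lemma ratio_gt0 i x : - r < x -> 0 < s i / (s i + x).
Proof. by move=> rx; rewrite divr_gt0 // shift_gt0. Qed.

Let chord_lt x y : - r < x -> x < y -> dof2 y < chord x y < dof2 x.
Proof.
move=> rx xy; have ry := lt_trans rx xy.
by apply/andP; split; apply: sum_lt_average => i; rewrite expr2;
  rewrite (ltr_pM2l, ltr_pM2r) ?ratio_gt0 //; exact: ratio_lt.
Qed.

Lemma dof2_lt x y : - r < x -> x < y -> dof2 y < dof2 x.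
Proof. by move=> rx /(chord_lt rx)/andP[]; apply: lt_trans. Qed.

Lemma dof2_gt0 x : - r < x -> 0 < dof2 x.
Proof.
move=> rx; apply: le_lt_trans (@dof2_lt _ (x + 1) rx _); last by rewrite ltrDl.
by rewrite /dof2 divr_ge0 ?ler0n // sumr_ge0 // => i _; exact: sqr_ge0.
Qed.

(** Termwise, [y s / (s + y) - x s / (s + x) = (y - x) s^2 / ((s + x) (s + y))]. The sign of
    [1 - psi * chord x y] thus decides monotonicity. *)
Let lam_sub psi x y : - r < x -> - r < y ->
  lam psi y - lam psi x = (y - x) * (1 - psi * chord x y).
Proof.
move=> rx ry.
have h : y * dof1 y - x * dof1 x = (y - x) * chord x y.
  rewrite /dof1 /chord !mulrA -mulrBl; congr (_ / _).
  rewrite !mulr_sumr -sumrB; apply: eq_bigr => i _.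
  by field; rewrite !sm0.
rewrite /lam; transitivity (y - x - psi * (y * dof1 y - x * dof1 x)); first by ring.
by rewrite h; ring.
Qed.

Lemma lam_0 psi : lam psi 0 = 0.
Proof. by rewrite /lam mul0r mulr0 subr0. Qed.

Lemma lam_increasing psi x y : 0 < psi -> - r < x -> psi * dof2 x <= 1 ->
  x < y -> lam psi x < lam psi y.
Proof.
move=> psi0 rx px xy; have ry := lt_trans rx xy.
rewrite -subr_gt0 lam_sub // mulr_gt0 ?subr_gt0 //.
apply: lt_le_trans px; rewrite ltr_pM2l //.
by have /andP[] := chord_lt rx xy.
Qed.

Lemma lam_decreasing psi x y : 0 < psi -> - r < x -> 1 <= psi * dof2 y ->
  x < y -> lam psi y < lam psi x.
Proof.
move=> psi0 rx py xy; have ry := lt_trans rx xy.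
rewrite -subr_lt0 lam_sub // pmulr_rlt0 ?subr_gt0 // subr_lt0.
apply: le_lt_trans py _; rewrite ltr_pM2l //.
by have /andP[] := chord_lt rx xy.
Qed.

Lemma lam_min psi a x : 0 < psi -> - r < a -> 1 = psi * dof2 a -> - r < x ->
  lam psi a <= lam psi x.
Proof.
move=> psi0 ra pa rx; have [xa|ax|->//] := ltgtP x a.
  by apply/ltW/lam_decreasing; rewrite -?pa.
by apply/ltW/lam_increasing; rewrite -?pa.
Qed.

Lemma ratio_cvg i (x : R) : - r < x ->
  s i / (s i + m) @[m --> x] --> s i / (s i + x).
Proof.
move=> rx; apply: cvgM; first exact: cvg_cst.
apply: cvgV; first exact: sm0.
by apply: cvgD; [exact: cvg_cst|exact: cvg_id].
Qed.

Lemma dof1_cvg (x : R) : - r < x -> dof1 m @[m --> x] --> dof1 x.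
Proof.
move=> rx; apply: cvgM; last exact: cvg_cst.
by apply: cvg_finsum => i; exact: ratio_cvg.
Qed.

Lemma dof2_cvg (x : R) : - r < x -> dof2 m @[m --> x] --> dof2 x.
Proof.
move=> rx; apply: cvgM; last exact: cvg_cst.
by apply: cvg_finsum => i; apply: cvgM; exact: ratio_cvg.
Qed.

Lemma lam_cvg psi (x : R) : - r < x -> lam psi m @[m --> x] --> lam psi x.
Proof.
move=> rx; apply: cvgB; first exact: cvg_id.
apply: cvgM; first exact: cvg_cst.
by apply: cvgM; [exact: cvg_id|exact: dof1_cvg].
Qed.

Let within_itv (f : R -> R) x y : - r < x ->
  (forall z, - r < z -> f m @[m --> z] --> f z) -> {within `[x, y], continuous f}.
Proof.
move=> rx h; apply: continuous_in_subspaceT => z; rewrite inE /= in_itv /=.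
by move=> /andP[xz _]; apply: h; exact: lt_le_trans xz.
Qed.

(* The two intermediate-value endpoints come from [dof2 >= (r / (r + x))^2 / p],
   attained by the eigenvalue [r], and [s i / (s i + y) <= psi^(-1/2)]. *)
Lemma dof2_surj psi : 0 < psi -> exists2 a, - r < a & 1 = psi * dof2 a.
Proof.
move=> psi0.
have q0 : 0 < Num.sqrt psi by rewrite sqrtr_gt0.
have qq : Num.sqrt psi ^+ 2 = psi by rewrite sqr_sqrtr // ltW.
set q := Num.sqrt psi in q0 qq.
pose u := Num.sqrt p%:R : R.
have u0 : 0 < u by rewrite sqrtr_gt0.
have uu : u ^+ 2 = p%:R by rewrite sqr_sqrtr // ltW.
(* Chosen so that [r + x = r * q / u]: the term of the eigenvalue [r] alone then brings
   [psi * dof2 x] up to [1]. *)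
pose x := r * q / u - r.
have rx : - r < x by rewrite /x ltrDr divr_gt0 // mulr_gt0.
(* The second entry dominates every [q * s i], so each ratio at [y] is at most [q^-1]. *)
pose y := Num.max x (q * \sum_i s i).
have xy : x <= y by rewrite le_max lexx.
have ry : - r < y by exact: lt_le_trans xy.
have fx : 1 <= psi * dof2 x.
  have [i si] := sr.
  have -> : 1 = psi * ((r / (r + x)) ^+ 2 / p%:R).
    rewrite /x addrCA subrr addr0 -qq -uu; field.
    by rewrite !gt_eqF.
  rewrite ler_pM2l // ler_pM2r ?invr_gt0 // (bigD1 i) //= si lerDl.
  by rewrite sumr_ge0 // => j _; exact: sqr_ge0.
have fy : psi * dof2 y <= 1.
  have h i : (s i / (s i + y)) ^+ 2 <= psi^-1.
    rewrite -qq -exprVn ler_pXn2r ?nnegrE ?invr_ge0 ?(ltW q0) //; last first.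
      exact/ltW/ratio_gt0.
    rewrite ler_pdivrMr ?shift_gt0 // ler_pdivlMl //.
    apply: (@le_trans _ _ y); last by rewrite lerDr ltW.
    rewrite le_max ler_pM2l // (bigD1 i) //= lerDl sumr_ge0 ?orbT //.
    by move=> j _; exact: ltW.
  rewrite -ler_pdivlMl // mulr1 /dof2 ler_pdivrMr //.
  apply: (le_trans (ler_sum _ (fun i _ => h i))).
  by rewrite sumr_const card_ord mulr_natr.
have [||c] := @IVT R (fun m => psi * dof2 m) x y 1 xy.
- apply: within_itv rx _ => z rz; apply: cvgM; first exact: cvg_cst.
  exact: dof2_cvg.
- by rewrite ge_min le_max fx fy orbT.
rewrite in_itv /= => /andP[xc _] <-; exists c => //; exact: lt_le_trans xc.
Qed.

(** Each [m / (s i + m)] is at most [1]. Consequently [lam psi m] is at least [m] minus a constant,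
    hence unbounded above. *)
Lemma dof1_le_average m : 0 <= m -> m * dof1 m <= (\sum_i s i) / p%:R.
Proof.
move=> m0; have rm : - r < m by apply: lt_le_trans m0; rewrite oppr_lt0.
rewrite /dof1 mulrA ler_pM2r ?invr_gt0 // mulr_sumr ler_sum // => i _.
rewrite mulrCA; apply: ler_piMr; first exact: ltW.
by rewrite ler_pdivrMr ?shift_gt0 // mul1r lerDr ltW.
Qed.

Lemma lam_surj psi a l : 0 < psi -> - r < a -> 1 = psi * dof2 a ->
  lam psi a < l -> exists2 m, a < m & lam psi m = l.
Proof.
move=> psi0 ra pa al.
pose y := Num.max (Num.max a 0) (l + psi * ((\sum_i s i) / p%:R)).
have ay : a <= y by rewrite !le_max lexx.
have y0 : 0 <= y by rewrite !le_max lexx orbT.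
have yl : l <= lam psi y.
  rewrite /lam lerBrDr; apply: (@le_trans _ _ (l + psi * ((\sum_i s i) / p%:R))).
    by rewrite lerD2l ler_pM2l // dof1_le_average.
  by rewrite !le_max lexx orbT.
have [||c] := @IVT R (lam psi) a y l ay.
- by apply: within_itv ra _ => z rz; exact: lam_cvg.
- by rewrite ge_min le_max (ltW al) yl orbT.
rewrite in_itv /= => /andP[ac _] cl; exists c => //.
by rewrite lt_def ac andbT; apply: contraTneq al => <-; rewrite -cl ltxx.
Qed.

(** For [m > 0] every ratio lies in [(0, 1)] and decreases when squared. A root of
    [psi * dof1 m = 1] therefore lies beyond [mu_min psi]. *)
Lemma dof2_lt_dof1 m : 0 < m -> dof2 m < dof1 m.
Proof.
move=> m0; have rm : - r < m by apply: lt_trans m0; rewrite oppr_lt0.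
apply: sum_lt_average => i; rewrite expr2 gtr_pMr ?ratio_gt0 //.
by rewrite ltr_pdivrMr ?shift_gt0 // mul1r ltrDl.
Qed.

Lemma dof1_lt x y : - r < x -> x < y -> dof1 y < dof1 x.
Proof. by move=> rx xy; apply: sum_lt_average => i; exact: ratio_lt. Qed.

Lemma dof1_gt0 m : - r < m -> 0 < dof1 m.
Proof.
move=> rm; apply: le_lt_trans (@dof1_lt _ (m + 1) rm _); last by rewrite ltrDl.
rewrite divr_ge0 ?ler0n // sumr_ge0 // => i _; apply/ltW/ratio_gt0.
by apply: lt_trans rm _; rewrite ltrDl.
Qed.

Lemma dof0 : dof1 0 = 1 /\ dof2 0 = 1.
Proof.
rewrite /dof1 /dof2; split; under eq_bigr do rewrite addr0 divff ?gt_eqF ?expr1n //.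
  by rewrite sumr_const card_ord divff ?gt_eqF.
by rewrite sumr_const card_ord divff ?gt_eqF.
Qed.

End Companion.

(** * The risk as a function of mu *)

(** If some value [f x] is strictly below both end limits, [f] stays above it near the ends, and the
    extreme value theorem on the compact interval in between gives the minimum. Otherwise the
    smaller end limit is the minimum. *)
Lemma min_open_ray (R : realType) (f : R -> R) (a : R) (L1 L2 : \bar R) :
  (forall x, a < x -> f m @[m --> x] --> f x) ->
  (f m)%:E @[m --> a^'+] --> L1 -> (f m)%:E @[m --> +oo] --> L2 ->
  exists X, [/\ [\/ X = L1, X = L2 | exists2 m, a < m & X = (f m)%:E],
    (X <= L1)%E, (X <= L2)%E & forall m, a < m -> (X <= (f m)%:E)%E].
Proof.
move=> fc f1 f2.
have [[x ax]|h] := pselect (exists2 x, a < x & ((f x)%:E < Order.min L1 L2)%E).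
  rewrite lt_min => /andP[xL1 xL2].
  have n1 : \forall m \near a^'+, ((f x)%:E < (f m)%:E)%E :=
    f1 _ (open_nbhs_nbhs (conj (@open_ereal_gt_ereal R (f x)%:E) xL1)).
  have n2 : \forall m \near +oo%R, ((f x)%:E < (f m)%:E)%E :=
    f2 _ (open_nbhs_nbhs (conj (@open_ereal_gt_ereal R (f x)%:E) xL2)).
  move: n1; rewrite near_withinE => /nbhs_ballP[e /= e0 ae].
  have [M [_ ltM]] := n2.
  (* Both choices keep [x] in [[c, d]], so the minimum there is at most [f x], hence at most every
     value outside. The half of [e] keeps [(a, c)] inside the ball. *)
  pose c := Num.min x (a + e / 2); pose d := Num.max x M.
  have ac : a < c by rewrite lt_min ax ltrDl divr_gt0.
  have cx : c <= x by rewrite ge_min lexx.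
  have xd : x <= d by rewrite le_max lexx.
  have [||m0] := @EVT_min R f c d; first exact: le_trans xd.
    apply: continuous_in_subspaceT => z; rewrite inE /= in_itv /= => /andP[cz _].
    by apply: fc; exact: lt_le_trans cz.
  rewrite in_itv /= => /andP[cm0 m0d] fmin.
  have m0x : f m0 <= f x by apply: fmin; rewrite in_itv /= cx.
  exists (f m0)%:E; split.
  - by apply: Or33; exists m0 => //; exact: lt_le_trans cm0.
  - by apply: le_trans (ltW xL1); rewrite lee_fin.
  - by apply: le_trans (ltW xL2); rewrite lee_fin.
  - move=> m am; rewrite lee_fin; have [mc|cm] := ltP m c.
      apply: (le_trans m0x); rewrite -lee_fin; apply/ltW/ae => //.
      rewrite /ball /= distrC ger0_norm ?subr_ge0 ?ltW // ltrBlDl.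
      apply: (lt_le_trans mc); rewrite ge_min; apply/orP; right.
      by rewrite lerD2l ler_pdivrMr // ler_pMr // ler1n.
    have [dm|md] := ltP d m; last by apply: fmin; rewrite in_itv /= cm.
    apply: (le_trans m0x); rewrite -lee_fin; apply/ltW/ltM.
    by apply: le_lt_trans dm; rewrite le_max lexx orbT.
exists (Order.min L1 L2); split.
- by case: (leP L1 L2) => _; [apply: Or31|apply: Or32].
- by rewrite ge_min lexx.
- by rewrite ge_min lexx orbT.
- by move=> m am; rewrite leNgt; apply/negP => mL; apply: h; exists m.
Qed.

Section Risk.
Variables (R : realType) (p : nat) (s : 'I_p -> R) (r : R).
Hypotheses (r0 : 0 < r) (rs : forall i, r <= s i) (sr : exists i, s i = r).
Variables (t b : 'I_p -> R) (sigma2 phi a : R) (A : R -> R) (K : R).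
Hypotheses (t0 : forall i, 0 < t i) (sigma20 : 0 <= sigma2) (phi0 : 0 < phi).
Hypotheses (ra : - r < a) (phia : 1 = phi * dof2 s a).
Hypotheses (Ac : forall x, - r < x -> A m @[m --> x] --> A x)
  (Ay : A m @[m --> +oo] --> K).

Let p0 : 0 < p%:R :> R.
Proof. by have [[i ip] _] := sr; rewrite ltr0n; apply: leq_ltn_trans ip. Qed.

Let s0 i : 0 < s i. Proof. exact: lt_le_trans r0 (rs i). Qed.

(* In an orthonormal eigenbasis of [Sigma] with eigenvalues [s], [t] is the
   diagonal of [Sigma0], [b] the coordinates of [beta], [A] the part of the risk
   without [vtilde], and [a = mu_min Sigma phi]; [vfun] is then [vtilde]. *)
Definition vnum (m : R) : R := (\sum_i t i * (s i / (s i + m) ^+ 2)) / p%:R.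

Definition vfun (m : R) : R := phi * vnum m / (1 - phi * dof2 s m).

(** This is [beta^T G Sigma G beta] with [G] the resolvent at [m]. *)
Definition qfun (m : R) : R := \sum_i b i ^+ 2 * (s i / (s i + m) ^+ 2).

Definition rfun (m : R) : R := A m + vfun m * (m ^+ 2 * qfun m + sigma2).

Let wsum_cvg (w : 'I_p -> R) (x : R) : - r < x ->
  \sum_i w i * (s i / (s i + m) ^+ 2) @[m --> x]
    --> \sum_i w i * (s i / (s i + x) ^+ 2).
Proof.
move=> rx; apply: cvg_finsum => i; apply: cvgM; first exact: cvg_cst.
apply: cvgM; first exact: cvg_cst.
have sx : s i + m @[m --> x] --> s i + x.
  by apply: cvgD; [exact: cvg_cst|exact: cvg_id].
apply: cvgV; first by rewrite expf_neq0 // gt_eqF // (shift_gt0 rs).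
by under eq_fun do rewrite expr2; rewrite expr2; exact: cvgM.
Qed.

Let vnum_cvg (x : R) : - r < x -> vnum m @[m --> x] --> vnum x.
Proof. by move=> rx; apply: cvgM; [exact: wsum_cvg|exact: cvg_cst]. Qed.

Let den_cvg (x : R) : - r < x ->
  1 - phi * dof2 s m @[m --> x] --> 1 - phi * dof2 s x.
Proof.
move=> rx; apply: cvgB; first exact: cvg_cst.
by apply: cvgM; [exact: cvg_cst|exact: (dof2_cvg rs)].
Qed.

Let coef_cvg (x : R) : - r < x ->
  m ^+ 2 * qfun m + sigma2 @[m --> x] --> x ^+ 2 * qfun x + sigma2.
Proof.
move=> rx; apply: cvgD; last exact: cvg_cst.
apply: cvgM; last exact: wsum_cvg.
by under eq_fun do rewrite expr2; rewrite expr2; apply: cvgM; exact: cvg_id.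
Qed.

Lemma den_gt0 x : a < x -> 0 < 1 - phi * dof2 s x.
Proof. by move=> ax; rewrite subr_gt0 phia ltr_pM2l // (dof2_lt r0 rs sr). Qed.

Let wsum_gt0 (w : 'I_p -> R) x : - r < x -> (forall i, 0 < w i) ->
  0 < \sum_i w i * (s i / (s i + x) ^+ 2).
Proof.
move=> rx w0; have [i _] := sr.
have h j : 0 < w j * (s j / (s j + x) ^+ 2).
  by rewrite mulr_gt0 // divr_gt0 // exprn_gt0 // (shift_gt0 rs).
by rewrite (bigD1 i) //= ltr_wpDr // sumr_ge0 // => j _; exact: ltW.
Qed.

Lemma vnum_gt0 x : - r < x -> 0 < vnum x.
Proof. by move=> rx; rewrite divr_gt0 // wsum_gt0. Qed.

Lemma vnum_lt x y : - r < x -> x < y -> vnum y < vnum x.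
Proof.
move=> rx xy; apply: (sum_lt_average sr) => i; rewrite ltr_pM2l // ltr_pM2l //.
have sx := shift_gt0 rs i rx; have sy := shift_gt0 rs i (lt_trans rx xy).
by rewrite ltf_pV2 ?posrE ?exprn_gt0 // ltr_pXn2r ?nnegrE ?ltW // ltrD2l.
Qed.

Lemma vfun_gt0 x : a < x -> 0 < vfun x.
Proof.
move=> ax; rewrite divr_gt0 ?den_gt0 // mulr_gt0 // vnum_gt0 //.
exact: lt_trans ax.
Qed.

(** Beyond [a] the positive numerator decreases and the positive denominator increases; the middle
    term changes only the numerator. *)
Lemma vfun_lt x y : a < x -> x < y -> vfun y < vfun x.
Proof.
move=> ax xy; have ay := lt_trans ax xy; have rx := lt_trans ra ax.
apply: (@lt_trans _ _ (phi * vnum x / (1 - phi * dof2 s y))).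
  by rewrite /vfun ltr_pM2r ?invr_gt0 ?den_gt0 // ltr_pM2l // vnum_lt.
rewrite /vfun ltr_pM2l; last by rewrite mulr_gt0 // vnum_gt0.
rewrite ltf_pV2 ?posrE ?den_gt0 // ltrD2l ltrN2.
by rewrite ltr_pM2l // (dof2_lt r0 rs sr).
Qed.

Lemma qfun_ge0 x : - r < x -> 0 <= qfun x.
Proof.
move=> rx; rewrite sumr_ge0 // => i _.
by rewrite mulr_ge0 ?sqr_ge0 // divr_ge0 ?exprn_ge0 ?ltW // (shift_gt0 rs).
Qed.

Lemma rfun_cvg x : a < x -> rfun m @[m --> x] --> rfun x.
Proof.
move=> ax; have rx := lt_trans ra ax.
apply: cvgD; first exact: Ac.
apply: cvgM; last exact: coef_cvg.
apply: cvgM; first by apply: cvgM; [exact: cvg_cst|exact: vnum_cvg].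
by apply: cvgV; [rewrite gt_eqF // den_gt0|exact: den_cvg].
Qed.

Let inv_cvgy i : (s i + m)^-1 @[m --> +oo] --> (0 : R).
Proof.
apply/gtr0_cvgV0.
  near=> m; rewrite addr_gt0 //; near: m; apply: nbhs_pinfty_gt; exact: num_real.
apply/cvgryPge => M; near=> m.
rewrite -lerBlDl; near: m; apply: nbhs_pinfty_ge; exact: num_real.
Unshelve. all: by end_near. Qed.

Lemma frac_cvgy i : m / (s i + m) @[m --> +oo] --> (1 : R).
Proof.
have h : 1 - s i * (s i + m)^-1 @[m --> +oo] --> 1 - s i * 0.
  apply: cvgB; first exact: cvg_cst.
  by apply: cvgM; [exact: cvg_cst|exact: inv_cvgy].
rewrite mulr0 subr0 in h; apply: cvg_trans h; apply: near_eq_cvg; near=> m.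
have m0 : 0 < m by near: m; apply: nbhs_pinfty_gt; exact: num_real.
by have := s0 i => si; field; rewrite gt_eqF // addr_gt0.
Unshelve. all: by end_near. Qed.

Let wsum_cvgy (w : 'I_p -> R) :
  \sum_i w i * (s i / (s i + m) ^+ 2) @[m --> +oo] --> (0 : R).
Proof.
have h : \sum_i w i * (s i / (s i + m) ^+ 2) @[m --> +oo]
    --> \sum_i w i * (s i * (0 * 0)).
  apply: cvg_finsum => i; under eq_fun do rewrite -exprVn expr2.
  apply: cvgM; first exact: cvg_cst.
  apply: cvgM; first exact: cvg_cst.
  by apply: cvgM; exact: inv_cvgy.
by rewrite [X in _ --> X]big1 in h => [|i _]; rewrite ?mulr0.
Qed.

Let coef_cvgy : m ^+ 2 * qfun m + sigma2 @[m --> +oo]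
  --> (\sum_i b i ^+ 2 * (s i * (1 * 1))) + sigma2.
Proof.
apply: cvgD; last exact: cvg_cst.
have -> : (fun m => m ^+ 2 * qfun m) =
    fun m => \sum_i b i ^+ 2 * (s i * (m / (s i + m) * (m / (s i + m)))).
  apply/funext => m; rewrite /qfun mulr_sumr; apply: eq_bigr => i _.
  by rewrite -expr2 expr_div_n; ring.
apply: cvg_finsum => i; apply: cvgM; first exact: cvg_cst.
apply: cvgM; first exact: cvg_cst.
by apply: cvgM; exact: frac_cvgy.
Qed.

Let vfun_cvgy : vfun m @[m --> +oo] --> (0 : R).
Proof.
have h : vfun m @[m --> +oo] --> phi * (0 / p%:R) / (1 - phi * (0 / p%:R)).
  apply: cvgM.
    apply: cvgM; first exact: cvg_cst.
    by apply: cvgM; [exact: wsum_cvgy|exact: cvg_cst].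
  apply: cvgV; first by rewrite mul0r mulr0 subr0 oner_eq0.
  apply: cvgB; first exact: cvg_cst.
  apply: cvgM; first exact: cvg_cst.
  apply: cvgM; last exact: cvg_cst.
  have := wsum_cvgy s; apply: cvg_trans; apply: near_eq_cvg; apply: nearW => m.
  by apply: eq_bigr => i _; rewrite expr_div_n; ring.
by rewrite mul0r mulr0 mul0r in h.
Qed.

(** At infinity [vfun] vanishes while its coefficient keeps a finite limit, so only [A] survives. *)
Lemma rfun_cvgy : rfun m @[m --> +oo] --> K.
Proof.
have h := cvgD Ay (cvgM vfun_cvgy coef_cvgy).
by rewrite mul0r addr0 in h; exact: h.
Qed.

(** The denominator of [vfun] vanishes at [a] and the other factors stay positive there. Divergence
    is obtained from the reciprocal, which tends to [0] through positive values; [A] stays bounded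
    below near [a]. *)
Lemma rfun_right_infty : 0 < a ^+ 2 * qfun a + sigma2 ->
  (rfun m)%:E @[m --> a^'+] --> +oo%E.
Proof.
move=> Ba.
have inv0 : (vfun m * (m ^+ 2 * qfun m + sigma2))^-1 @[m --> a^'+] --> (0 : R).
  have -> : 0 = (1 - phi * dof2 s a) / (phi * vnum a) / (a ^+ 2 * qfun a + sigma2) :> R.
    by rewrite -phia subrr !mul0r.
  under eq_fun do rewrite invfM invf_div.
  apply: cvgM; last first.
    by apply: cvgV; [rewrite gt_eqF|apply: cvg_at_right_filter; exact: coef_cvg].
  apply: cvgM; first by apply: cvg_at_right_filter; exact: den_cvg.
  apply: cvgV; first by rewrite gt_eqF // mulr_gt0 // vnum_gt0.
  by apply: cvgM; [exact: cvg_cst|apply: cvg_at_right_filter; exact: vnum_cvg].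
have coef0 : \forall m \near a^'+, 0 < m ^+ 2 * qfun m + sigma2.
  have /cvg_at_right_filter h := coef_cvg ra.
  exact: (cvgr_gt _ h).
have : vfun m * (m ^+ 2 * qfun m + sigma2) @[m --> a^'+] --> +oo.
  apply/gtr0_cvgV0 => //; near=> m; apply: mulr_gt0; last by near: m.
  by apply: vfun_gt0; near: m; exact: nbhs_right_gt.
move=> /cvgryPge vy; apply/cvgeryP/cvgryPge => M; near=> m.
have Am : A a - 1 <= A m.
  near: m; have /cvg_at_right_filter h := Ac ra.
  by apply: (cvgr_ge _ h); rewrite ltrBlDr ltrDl.
have vm : M - (A a - 1) <= vfun m * (m ^+ 2 * qfun m + sigma2).
  by near: m; exact: vy.
by rewrite /rfun -(subrK (A a - 1) M) addrC lerD.
Unshelve. all: by end_near. Qed.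

(** If the coefficient of [vfun] is positive at [a], the limit is [+oo]. Otherwise its two
    nonnegative summands both vanish, and the product with [vfun] tends to [0]. *)
Lemma rfun_right : exists L : \bar R, (rfun m)%:E @[m --> a^'+] --> L.
Proof.
have AE : (A m)%:E @[m --> a^'+] --> (A a)%:E.
  by apply: cvg_EFin; [exact: nearW|apply: cvg_at_right_filter; exact: Ac].
have [Ba|] := ltP 0 (a ^+ 2 * qfun a + sigma2).
  by exists +oo%E; exact: rfun_right_infty.
move=> B0; have q0 := qfun_ge0 ra.
have [a2q sg] : a ^+ 2 * qfun a = 0 /\ sigma2 = 0.
  have aq0 : 0 <= a ^+ 2 * qfun a by rewrite mulr_ge0 // sqr_ge0.
  by split; apply/eqP; rewrite eq_le; apply/andP; split; have := sigma20; lra.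
have [a0|aN0] := eqVneq a 0; last first.
  (* For [a != 0], [qfun a = 0] forces every [b i] to vanish, so [rfun] coincides with [A] to the
     right of [a]. *)
  exists (A a)%:E; apply: cvg_trans AE; apply: near_eq_cvg; near=> m.
  congr (_%:E); rewrite /rfun sg addr0 (_ : qfun m = 0) ?mulr0 ?addr0 //.
  move/eqP: a2q; rewrite mulf_eq0 sqrf_eq0 (negPf aN0) /= psumr_eq0; last first.
    move=> i _; rewrite mulr_ge0 ?sqr_ge0 // divr_ge0 ?exprn_ge0 ?ltW //.
    exact: (shift_gt0 rs).
  move=> /allP h; rewrite /qfun big1 // => i _.
  have := h i (mem_index_enum i); rewrite /= mulf_eq0 sqrf_eq0.
  move=> /orP[/eqP ->|]; first by rewrite expr2 !mul0r.
  by rewrite gt_eqF // divr_gt0 // exprn_gt0 // (shift_gt0 rs).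
(* Here [phi = 1] and [sigma2 = 0]: the pole of [vfun] at [0] is simple and is
   cancelled by the factor [m ^+ 2]. *)
have phi1 : phi = 1 by have [_ d] := dof0 r0 rs sr; rewrite phia a0 d mulr1.
(* The quotient of [1 - dof2 s m] by [m]; its value at [0] is positive, which makes the zero
   simple. *)
pose E m : R := (\sum_i (2 * s i + m) / (s i + m) ^+ 2) / p%:R.
exists (A a)%:E; apply: cvg_EFin; first exact: nearW.
have rz : - r < 0 by rewrite -a0.
have denE m : - r < m -> 1 - dof2 s m = m * E m.
  move=> rm; rewrite /dof2 /E mulrA.
  have one : (\sum_(i < p) 1) / p%:R = 1 :> R.
    by rewrite sumr_const card_ord divff ?gt_eqF.
  rewrite -[X in X - _]one -mulrBl -sumrB mulr_sumr; congr (_ / _); apply: eq_bigr => i _.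
  by field; rewrite gt_eqF // (shift_gt0 rs).
have E0 : 0 < E 0.
  have -> : E 0 = (\sum_i 2 * (s i / (s i + 0) ^+ 2)) / p%:R.
    by congr (_ / _); apply: eq_bigr => i _; rewrite addr0; ring.
  by rewrite divr_gt0 // (wsum_gt0 (w := fun=> 2)).
have Ec : E m @[m --> a^'+] --> E 0.
  rewrite a0; apply: cvg_at_right_filter; apply: cvgM; last exact: cvg_cst.
  apply: cvg_finsum => i; apply: cvgM.
    by apply: cvgD; [exact: cvg_cst|exact: cvg_id].
  have sx : s i + m @[m --> (0 : R)] --> s i + 0.
    by apply: cvgD; [exact: cvg_cst|exact: cvg_id].
  apply: cvgV; first by rewrite expf_neq0 // gt_eqF // (shift_gt0 rs).
  by under eq_fun do rewrite expr2; rewrite expr2; exact: cvgM.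
have h : A m + (vnum m * (m * qfun m) / E m) @[m --> a^'+]
    --> A a + (vnum 0 * (0 * qfun 0) / E 0).
  apply: cvgD; first by apply: cvg_at_right_filter; exact: Ac.
  apply: cvgM; last by apply: cvgV; rewrite ?gt_eqF.
  rewrite a0; apply: cvg_at_right_filter; apply: cvgM; first exact: vnum_cvg.
  by apply: cvgM; [exact: cvg_id|exact: wsum_cvg].
rewrite mul0r mulr0 mul0r addr0 in h.
apply: cvg_trans h; apply: near_eq_cvg; near=> m => /=.
have m0 : 0 < m by rewrite -[X in X < _]a0; near: m; exact: nbhs_right_gt.
have rm := lt_trans rz m0.
rewrite /rfun /vfun phi1 !mul1r denE // sg addr0.
have Em : E m != 0.
  rewrite gt_eqF // divr_gt0 //; have [i _] := sr.
  have g j : 0 < (2 * s j + m) / (s j + m) ^+ 2.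
    by rewrite divr_gt0 ?exprn_gt0 ?(shift_gt0 rs) // addr_gt0 // mulr_gt0.
  by rewrite (bigD1 i) //= ltr_wpDr // sumr_ge0 // => j _; exact: ltW.
by field; rewrite Em gt_eqF.
Unshelve. all: by end_near. Qed.

End Risk.

(** * The change of variables from lambda to mu *)

Lemma r_min_spectral (R : realType) p (P : 'M[R]_p) (d : 'rV[R]_p) :
  (0 < p)%N -> P *m P^T = 1%:M ->
  let r := r_min (spectral_fun P d id) in
  (forall i, r <= d 0 i) /\ exists i, d 0 i = r.
Proof.
move=> p0 PP r.
pose i0 := [arg min_(i < Ordinal p0) d 0 i]%O.
have i0min j : d 0 i0 <= d 0 j by rewrite /i0; case: arg_minP => // i _; apply.
suff -> : r = d 0 i0 by split => //; exists i0.
apply/eqP; rewrite eq_le; apply/andP; split.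
  apply: ge_inf; last by rewrite /= eigenvalue_spectral //; apply/existsP; exists i0.
  by exists (d 0 i0) => a /=; rewrite eigenvalue_spectral // => /existsP[j /eqP <-].
apply: lb_le_inf.
  by exists (d 0 i0); rewrite /= eigenvalue_spectral //; apply/existsP; exists i0.
by move=> a /=; rewrite eigenvalue_spectral // => /existsP[j /eqP <-].
Qed.

Section Link.
Variables (R : realType) (p : nat) (P : 'M[R]_p) (d : 'rV[R]_p).
Hypothesis PP : P *m P^T = 1%:M.
Let s i := d 0 i.
Local Notation Sigma := (spectral_fun P d id).
Let r := r_min Sigma.
Hypotheses (r0 : 0 < r) (rs : forall i, r <= s i) (sr : exists i, s i = r).

Let sm0 i m : - r < m -> s i + m != 0.
Proof. by move=> rm; rewrite gt_eqF // (shift_gt0 rs). Qed.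

Lemma resolvent_spectral m : - r < m ->
  resolvent Sigma m = spectral_fun P d (fun x => (x + m)^-1).
Proof. by move=> rm; apply: spectral_fun_inv => // i; exact: sm0. Qed.

Lemma trbar_dof1 m : - r < m ->
  trbar (m *: (Sigma *m resolvent Sigma m)) = m * dof1 s m.
Proof.
move=> rm; rewrite resolvent_spectral // spectral_funM // /trbar mxtraceZ.
by rewrite mxtrace_spectral_fun1 // -mulrA.
Qed.

Lemma df2_dof2 m : - r < m -> df2 Sigma m = dof2 s m.
Proof.
move=> rm; rewrite /df2 resolvent_spectral // !spectral_funM // /trbar.
rewrite mxtrace_spectral_fun1 //; congr (_ / _); apply: eq_bigr => i _.
by rewrite expr2 /s; ring.
Qed.

Lemma trbar_vnum Sigma0 m : - r < m ->
  trbar (Sigma0 *m Sigma *m resolvent Sigma m *m resolvent Sigma m) =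
  vnum s (fun i => (P *m Sigma0 *m P^T) i i) m.
Proof.
move=> rm; rewrite resolvent_spectral // -2!mulmxA !spectral_funM // /trbar.
rewrite mxtrace_spectral_fun //; congr (_ / _); apply: eq_bigr => i _.
by rewrite /s -exprVn expr2.
Qed.

(** Existence, from [dof2_surj], guarantees that [xget] returns a root and not its default;
    [mu_spec] does the same with [lam_surj]. *)
Lemma mu_min_spec psi : 0 < psi ->
  - r < mu_min Sigma psi /\ 1 = psi * dof2 s (mu_min Sigma psi).
Proof.
move=> psi0; have [a ra pa] := dof2_surj r0 rs sr psi0.
have : [set m : R | - r_min Sigma < m /\ 1 = psi * df2 Sigma m] (mu_min Sigma psi).
  by apply: (xgetPex 0); exists a; split => //; rewrite df2_dof2.
by case=> h1 h2; split => //; rewrite -df2_dof2.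
Qed.

Lemma lambda_min_lam psi : 0 < psi ->
  lambda_min Sigma psi = lam s psi (mu_min Sigma psi).
Proof. by move=> psi0; rewrite /lambda_min trbar_dof1 //; case: (mu_min_spec psi0). Qed.

Lemma mu_spec psi l : 0 < psi -> lambda_min Sigma psi < l ->
  mu_min Sigma psi < mu Sigma l psi /\ lam s psi (mu Sigma l psi) = l.
Proof.
move=> psi0; rewrite lambda_min_lam // => ll.
have [ra pa] := mu_min_spec psi0.
have [m am ml] := lam_surj r0 rs sr psi0 ra pa ll.
have : [set m : R | mu_min Sigma psi < m /\
    m = l + psi * trbar (m *: (Sigma *m resolvent Sigma m))] (mu Sigma l psi).
  apply: (xgetPex 0); exists m; split => //; rewrite trbar_dof1 ?(lt_trans ra) //.
  by rewrite -ml /lam subrK.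
case=> h1 h2; split => //; move: h2; rewrite trbar_dof1 ?(lt_trans ra) //.
by rewrite /lam => {1}->; rewrite addrK.
Qed.

Lemma lam_homo psi x y : 0 < psi -> mu_min Sigma psi <= x -> x < y ->
  lam s psi x < lam s psi y.
Proof.
move=> psi0 ax xy; have [ra pa] := mu_min_spec psi0.
apply: (lam_increasing r0 rs sr psi0 _ _ xy).
  exact: lt_le_trans ax.
move: ax; rewrite le_eqVlt => /predU1P[<-|ax]; first by rewrite -pa.
by rewrite [leRHS]pa ler_pM2l // ltW // (dof2_lt r0 rs sr).
Qed.

(** [mu] inverts the increasing map [lam], so bounds on [mu] become bounds on [lambda]. The limits
    of [mu] are read off from this, without a continuity argument for the inverse. *)
Lemma mu_lt psi l m : 0 < psi -> lambda_min Sigma psi < l ->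
  mu_min Sigma psi < m -> (mu Sigma l psi < m) = (l < lam s psi m).
Proof.
move=> psi0 ll am; have [h1 h2] := mu_spec psi0 ll.
apply/idP/idP => [h|]; first by rewrite -h2 lam_homo // ltW.
rewrite -{1}h2; apply: contraTT; rewrite -!leNgt le_eqVlt => /predU1P[->//|h].
by rewrite ltW // lam_homo // ltW.
Qed.

Lemma mu_lam psi m : 0 < psi -> mu_min Sigma psi < m ->
  lambda_min Sigma psi < lam s psi m /\ mu Sigma (lam s psi m) psi = m.
Proof.
move=> psi0 am; have [ra pa] := mu_min_spec psi0.
have lm : lambda_min Sigma psi < lam s psi m by rewrite lambda_min_lam // lam_homo.
split => //; have [h1 h2] := mu_spec psi0 lm.
case: (ltgtP (mu Sigma (lam s psi m) psi) m) => // h.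
  by have := lam_homo psi0 (ltW h1) h; rewrite h2 ltxx.
by have := lam_homo psi0 (ltW am) h; rewrite h2 ltxx.
Qed.

Lemma mu_min_lt psi psi' : 0 < psi -> psi < psi' ->
  mu_min Sigma psi < mu_min Sigma psi'.
Proof.
move=> psi0 pp; have [ra pa] := mu_min_spec psi0.
have [ra' pa'] := mu_min_spec (lt_trans psi0 pp).
rewrite ltNge; apply/negP => h.
have : psi * dof2 s (mu_min Sigma psi) < psi' * dof2 s (mu_min Sigma psi').
  apply: (@lt_le_trans _ _ (psi' * dof2 s (mu_min Sigma psi))).
    by rewrite ltr_pM2r // (dof2_gt0 r0 rs sr).
  rewrite ler_pM2l ?(lt_trans psi0) //; move: h; rewrite le_eqVlt => /predU1P[->//|h].
  by rewrite ltW // (dof2_lt r0 rs sr).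
by rewrite -pa -pa' ltxx.
Qed.

Lemma mu_cvg psi : 0 < psi ->
  mu Sigma l psi @[l --> (lambda_min Sigma psi)^'+] --> (mu_min Sigma psi)^'+.
Proof.
move=> psi0 Q /=; rewrite /nbhs /= /at_right /= => /nbhs_ballP[e /= e0 aQ].
have [m am me] : exists2 m, mu_min Sigma psi < m & m < mu_min Sigma psi + e.
  by exists (mu_min Sigma psi + e / 2); rewrite ?ltrDl ?ltrD2l ?divr_gt0 //; lra.
have lm := lam_homo psi0 (lexx _) am; rewrite -lambda_min_lam // in lm.
near=> l.
have ll : lambda_min Sigma psi < l by near: l; exact: nbhs_right_gt.
have [h1 _] := mu_spec psi0 ll.
apply: aQ => //; rewrite /ball /= distrC gtr0_norm ?subr_gt0 // ltrBlDl.
apply: lt_trans me; rewrite mu_lt //; near: l; exact: nbhs_right_lt.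
Unshelve. all: by end_near. Qed.

Lemma mu_cvgy psi : 0 < psi -> mu Sigma l psi @[l --> +oo] --> +oo.
Proof.
move=> psi0; apply/cvgryPge => M; near=> l.
pose m := Num.max (mu_min Sigma psi + 1) M.
have am : mu_min Sigma psi < m by rewrite lt_max ltrDl ltr01.
have ll : lambda_min Sigma psi < l.
  by near: l; apply: nbhs_pinfty_gt; exact: num_real.
apply: (@le_trans _ _ m); first by rewrite le_max lexx orbT.
rewrite leNgt mu_lt // -leNgt; near: l; apply: nbhs_pinfty_ge; exact: num_real.
Unshelve. all: by end_near. Qed.

(** Since [psi * dof2] equals [1] at [mu_min psi], having [mu_min psi] below a fixed [m] would bound
    [psi] by the inverse of [dof2 s m]. *)
Lemma mu_min_cvgy : mu_min Sigma psi @[psi --> +oo] --> +oo.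
Proof.
apply/cvgryPge => M; pose m := Num.max 0 M.
have rm : - r < m by rewrite (@lt_le_trans _ _ 0) ?oppr_lt0 // le_max lexx.
have d0 := dof2_gt0 r0 rs sr rm.
near=> psi.
have psi0 : 0 < psi by near: psi; apply: nbhs_pinfty_gt; exact: num_real.
have [ra pa] := mu_min_spec psi0.
apply: (@le_trans _ _ m); first by rewrite le_max lexx orbT.
rewrite leNgt; apply/negP => /(dof2_lt r0 rs sr ra) h.
have : psi < (dof2 s m)^-1.
  by rewrite -[ltRHS]mul1r ltr_pdivlMr // pa ltr_pM2l.
apply/negP; rewrite -leNgt; near: psi; apply: nbhs_pinfty_ge; exact: num_real.
Unshelve. all: by end_near. Qed.

End Link.

(** * Values of the extended risk *)

Lemma trmx_spectral_fun (R : fieldType) p (P : 'M[R]_p) (d : 'rV[R]_p) f :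
  (spectral_fun P d f)^T = spectral_fun P d f.
Proof. by rewrite /spectral_fun !trmx_mul trmxK tr_diag_mx mulmxA. Qed.

Lemma bilin_sum (R : realType) p (u v : 'cV[R]_p) (M : 'M[R]_p) :
  bilin u M v = \sum_i \sum_j u i 0 * M i j * v j 0.
Proof.
rewrite exchange_big /bilin mxE; apply: eq_bigr => j _ /=.
by rewrite mxE mulr_suml; apply: eq_bigr => i _; rewrite mxE.
Qed.

Lemma bilin_mul (R : realType) p (u v : 'cV[R]_p) (A M B : 'M[R]_p) :
  bilin u (A *m M *m B) v = bilin (A^T *m u) M (B *m v).
Proof. by rewrite /bilin trmx_mul trmxK !mulmxA. Qed.

Section RiskLink.
Variables (R : realType) (p : nat) (P : 'M[R]_p) (d : 'rV[R]_p).
Hypothesis PP : P *m P^T = 1%:M.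
Local Notation s := (fun i => d 0 i).
Local Notation Sigma := (spectral_fun P d id).
Local Notation r := (r_min Sigma).
Hypotheses (r0 : 0 < r) (rs : forall i, r <= s i) (sr : exists i, s i = r).
Variables (Sigma0 : 'M[R]_p) (beta beta0 : 'cV[R]_p) (sigma2 sigma02 phi : R).
Hypotheses (S0sym : symmetric_mx Sigma0) (S0eig : eigenvalues_bounded Sigma0).
Hypotheses (sigma20 : 0 <= sigma2) (phi0 : 0 < phi).

Let b i := (P *m beta) i 0.
Let M0 := P *m Sigma0 *m P^T.
Let q i := (P *m (Sigma0 *m (beta0 - beta))) i 0.
Let k := bilin (beta0 - beta) Sigma0 (beta0 - beta) + sigma02.

(** The part of the risk without [vtilde], in the eigenbasis. Powers of [m] are distributed so that
    [m] occurs only in ratios [m / (s i + m)], which converge also at infinity. *)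
Definition bias (m : R) : R :=
  \sum_i \sum_j b i * M0 i j * b j * (m / (s i + m) * (m / (s j + m)))
  + \sum_i 2 * b i * q i * (m / (s i + m)) + k.

(* The limit of [bias] at [+oo]: every ratio [m / (s i + m)] tends to [1]. *)
Definition bias_limit : R :=
  \sum_i \sum_j b i * M0 i j * b j * (1 * 1) + \sum_i 2 * b i * q i * 1 + k.

Definition risk_of_mu : R -> R := rfun s (fun i => M0 i i) b sigma2 phi bias.

Let a := mu_min Sigma phi.

Let fracs_cvg (T : Type) (F : set_system T) {FF : Filter F} (f : 'I_p -> T -> R)
    (l : 'I_p -> R) :
  (forall i, f i m @[m --> F] --> l i) ->
  \sum_i \sum_j b i * M0 i j * b j * (f i m * f j m)
  + \sum_i 2 * b i * q i * f i m + k @[m --> F] -->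
  \sum_i \sum_j b i * M0 i j * b j * (l i * l j)
  + \sum_i 2 * b i * q i * l i + k.
Proof.
move=> fl; apply: cvgD; last exact: cvg_cst.
apply: cvgD; apply: cvg_finsum => i.
  apply: cvg_finsum => j; apply: cvgM; first exact: cvg_cst.
  exact: cvgM.
by apply: cvgM; first exact: cvg_cst.
Qed.

Lemma bias_cvg x : - r < x -> bias m @[m --> x] --> bias x.
Proof.
move=> rx; apply: (fracs_cvg (f := fun i m => m / (s i + m))) => i.
apply: cvgM; first exact: cvg_id.
apply: cvgV; first by rewrite gt_eqF // (shift_gt0 rs).
by apply: cvgD; [exact: cvg_cst|exact: cvg_id].
Qed.

Lemma bias_cvgy : bias m @[m --> +oo] --> bias_limit.
Proof.
apply: (fracs_cvg (f := fun i m => m / (s i + m)) (l := fun=> 1)) => i.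
exact: (frac_cvgy r0 rs).
Qed.

Lemma biasE m : - r < m -> let G := resolvent Sigma m in
  bias m = m ^+ 2 * bilin beta (G *m Sigma0 *m G) beta
    + 2 * m * bilin beta (G *m Sigma0) (beta0 - beta) + k.
Proof.
move=> rm G; rewrite /G resolvent_spectral //; congr (_ + _ + _).
  rewrite bilin_mul trmx_spectral_fun.
  set u := spectral_fun P d _ *m beta.
  have -> : bilin u Sigma0 u = bilin (P *m u) M0 (P *m u).
    by rewrite /M0 bilin_mul mulmxA (mulmx1C PP) mul1mx.
  rewrite bilin_sum mulr_sumr; apply: eq_bigr => i _.
  rewrite mulr_sumr; apply: eq_bigr => j _.
  by rewrite /u !spectral_fun_apply // -/(b i) -/(b j); ring.
have -> : bilin beta (spectral_fun P d (fun x => (x + m)^-1) *m Sigma0) (beta0 - beta)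
    = \sum_i (P *m (spectral_fun P d (fun x => (x + m)^-1) *m beta)) i 0 * q i.
  set u := spectral_fun P d _ *m beta.
  rewrite -[_ *m Sigma0]mulmx1 bilin_mul trmx_spectral_fun -/u mul1mx.
  have h : (P *m u)^T *m (P *m (Sigma0 *m (beta0 - beta))) =
      u^T *m Sigma0 *m (beta0 - beta).
    by rewrite (trmx_mul P u) -(mulmxA u^T P^T) (mulmxA P^T) (mulmx1C PP) mul1mx mulmxA.
  by rewrite /bilin -h mxE; apply: eq_bigr => i _; rewrite mxE.
rewrite mulr_sumr; apply: eq_bigr => i _.
by rewrite spectral_fun_apply // -/(b i); ring.
Qed.

Lemma bilin_qfun m : - r < m -> let G := resolvent Sigma m in
  bilin beta (G *m Sigma *m G) beta = qfun s b m.
Proof.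
move=> rm G; rewrite /G resolvent_spectral // !spectral_funM //.
rewrite bilin_spectral_fun //; apply: eq_bigr => i _.
by rewrite -/(b i) -exprVn; ring.
Qed.

Lemma risk_intE l psi : - r < mu Sigma l psi ->
  risk_int Sigma Sigma0 beta beta0 sigma2 sigma02 phi l psi =
  risk_of_mu (mu Sigma l psi).
Proof.
rewrite /risk_int /vtilde; set m := mu _ _ _ => rm.
rewrite trbar_vnum // df2_dof2 //.
rewrite -[phi * _ / _]/(vfun s (fun i => M0 i i) phi m); set v := vfun _ _ _ _.
rewrite mulmxDr mulmxDl -scalemxAr -scalemxAl.
have -> u X Y : bilin u (v *: X + Y) u = v * bilin u X u + bilin u Y u.
  by rewrite /bilin mulmxDr mulmxDl -scalemxAr -scalemxAl !mxE.
by rewrite bilin_qfun // /risk_of_mu /rfun -/v biasE // /k; ring.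
Qed.

(** The diagonal entry is the quadratic form of [Sigma0] at row [i] of [P], a nonzero vector. *)
Let t0 i : 0 < M0 i i.
Proof.
have -> : M0 i i = bilin (row i P)^T Sigma0 (row i P)^T.
  by rewrite /bilin trmxK /M0 tr_row -row_mul !mxE; apply: eq_bigr => j _; rewrite !mxE.
apply: bilin_gt0 => //; apply/negP => /eqP/(congr1 trmx); rewrite trmxK trmx0 => Pi0.
have : row i (P *m P^T) = 0 by rewrite row_mul Pi0 mul0mx.
by rewrite PP row1 => /rowP/(_ i); rewrite !mxE !eqxx => /eqP; rewrite oner_eq0.
Qed.

Let ra : - r < a. Proof. by case: (mu_min_spec PP r0 rs sr phi0). Qed.
Let phia : 1 = phi * dof2 s a.
Proof. by case: (mu_min_spec PP r0 rs sr phi0). Qed.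

Lemma risk_of_mu_cvg x : a < x -> risk_of_mu m @[m --> x] --> risk_of_mu x.
Proof. move=> ax.
exact: (rfun_cvg r0 rs sr phi0 ra phia bias_cvg ax). Qed.

Lemma risk_of_mu_cvgy : risk_of_mu m @[m --> +oo] --> bias_limit.
Proof. by apply: (rfun_cvgy r0 rs); exact: bias_cvgy. Qed.

Lemma risk_of_mu_right :
  exists L : \bar R, (risk_of_mu m)%:E @[m --> a^'+] --> L.
Proof. exact: (rfun_right r0 rs sr _ t0 sigma20 phi0 ra phia bias_cvg). Qed.

Local Notation risk_at_psi := (risk_fin Sigma Sigma0 beta beta0 sigma2 sigma02 phi).
Local Notation Rk := (risk Sigma Sigma0 beta beta0 sigma2 sigma02 phi).

Lemma risk_fin_gt l psi : 0 < psi -> lambda_min Sigma psi < l ->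
  risk_at_psi l%:E psi = (risk_of_mu (mu Sigma l psi))%:E.
Proof.
move=> psi0 ll; rewrite /risk_fin ll risk_intE //.
have [h _] := mu_spec PP r0 rs sr psi0 ll.
by apply: lt_trans h; case: (mu_min_spec PP r0 rs sr psi0).
Qed.

Lemma risk_lam psi m : 0 < psi -> mu_min Sigma psi < m ->
  Rk (lam s psi m)%:E psi%:E = (risk_of_mu m)%:E.
Proof.
move=> psi0 am; have [ll mE] := mu_lam PP r0 rs sr psi0 am.
by rewrite /risk risk_fin_gt // mE.
Qed.

Let risk_int_eq psi l : 0 < psi -> lambda_min Sigma psi < l ->
  risk_int Sigma Sigma0 beta beta0 sigma2 sigma02 phi l psi =
  risk_of_mu (mu Sigma l psi).
Proof.
by move=> psi0 ll; have := risk_fin_gt psi0 ll; rewrite /risk_fin ll => -[].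
Qed.

Lemma risk_fin_le l psi (L : \bar R) : 0 < psi -> l <= lambda_min Sigma psi ->
  (risk_of_mu m)%:E @[m --> (mu_min Sigma psi)^'+] --> L ->
  risk_at_psi l%:E psi = L.
Proof.
move=> psi0 ll FL; rewrite /risk_fin ltNge ll /=; apply: cvg_lim => //.
have h := cvg_comp _ _ (mu_cvg PP r0 rs sr psi0) FL.
apply: cvg_trans h; apply: near_eq_cvg; near=> l' => /=.
by rewrite risk_int_eq //; near: l'; exact: nbhs_right_gt.
Unshelve. all: by end_near. Qed.

(** For [psi > phi] the point [mu_min psi] lies strictly beyond [a], where [risk_of_mu] is
    continuous; the boundary limit is an ordinary value. *)
Lemma risk_fin_le_gt l psi : phi < psi -> l <= lambda_min Sigma psi ->
  risk_at_psi l%:E psi = (risk_of_mu (mu_min Sigma psi))%:E.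
Proof.
move=> pp ll; apply: (risk_fin_le (lt_trans phi0 pp) ll).
apply: cvg_EFin; first exact: nearW.
apply: cvg_at_right_filter; apply: risk_of_mu_cvg.
exact: (mu_min_lt PP r0 rs sr).
Qed.

Lemma risk_fin_y psi : 0 < psi -> risk_at_psi +oo%E psi = bias_limit%:E.
Proof.
move=> psi0; rewrite /risk_fin; apply: cvg_lim => //.
apply: cvg_EFin; first exact: nearW.
have h := cvg_comp _ _ (mu_cvgy PP r0 rs sr psi0) risk_of_mu_cvgy.
apply: cvg_trans h; apply: near_eq_cvg; near=> l' => /=.
rewrite risk_int_eq //; near: l'; apply: nbhs_pinfty_gt; exact: num_real.
Unshelve. all: by end_near. Qed.

Lemma risk_psi_y l : l != -oo%E -> Rk l +oo%E = bias_limit%:E.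
Proof.
case: l => [l _|_|//]; rewrite /risk; apply: cvg_lim => //.
  (* The argument at which [risk_of_mu] is evaluated on either side of [lambda_min psi]. It is at
     least [mu_min psi], hence diverges. *)
  pose g psi := if lambda_min Sigma psi < l then mu Sigma l psi else mu_min Sigma psi.
  have gy : g psi @[psi --> +oo] --> +oo.
    apply: (ger_cvgy _ (mu_min_cvgy PP r0 rs sr)); near=> psi.
    rewrite /g; case: ifPn => // ll; apply: ltW.
    have psi0 : 0 < psi by near: psi; apply: nbhs_pinfty_gt; exact: num_real.
    by have [] := mu_spec PP r0 rs sr psi0 ll.
  have h : (risk_of_mu (g psi))%:E @[psi --> +oo] --> bias_limit%:E.
    apply: cvg_EFin; first exact: nearW.
    exact: (cvg_comp _ _ gy risk_of_mu_cvgy).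
  apply: cvg_trans h; apply: near_eq_cvg; near=> psi.
  have pp : phi < psi by near: psi; apply: nbhs_pinfty_gt; exact: num_real.
  rewrite /g; case: ltP => ll; first by rewrite risk_fin_gt // (lt_trans phi0).
  by rewrite risk_fin_le_gt.
have h : (fun _ : R => bias_limit%:E) @ pinfty_nbhs R --> bias_limit%:E.
  exact: cvg_cst.
apply: cvg_trans h; apply: near_eq_cvg; near=> psi.
have psi0 : 0 < psi by near: psi; apply: nbhs_pinfty_gt; exact: num_real.
by rewrite risk_fin_y.
Unshelve. all: by end_near. Qed.

(** * Lower bound and attainment of the minimum *)

Section Values.
Variable L : \bar R.
Hypothesis FL : (risk_of_mu m)%:E @[m --> a^'+] --> L.
Local Notation lmin := (lambda_min Sigma phi).

Lemma risk_lmin : Rk lmin%:E phi%:E = L.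
Proof. exact: risk_fin_le. Qed.

(** Every such value is either [risk_of_mu] at a point beyond [a] or one of its two end limits,
    because [mu_min psi >= a]. Below [lambda_min psi], [risk_fin] returns the boundary value. *)
Lemma risk_values_ge X : (X <= L)%E -> (X <= bias_limit%:E)%E ->
  (forall m, a < m -> (X <= (risk_of_mu m)%:E)%E) ->
  forall l psi, l != -oo%E -> (phi%:E <= psi)%E -> (X <= Rk l psi)%E.
Proof.
move=> XL XK XF l [psi||] lN; last by []; last by rewrite risk_psi_y.
rewrite lee_fin => pp; have psi0 : 0 < psi by exact: lt_le_trans pp.
case: l lN => [l _|_|//]; last by rewrite /risk risk_fin_y.
rewrite /risk; have [ll|ll] := ltP (lambda_min Sigma psi) l.
  rewrite risk_fin_gt //; apply: XF.
  have [h _] := mu_spec PP r0 rs sr psi0 ll; apply: le_lt_trans h.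
  move: pp; rewrite le_eqVlt => /predU1P[<-//|pp].
  exact/ltW/(mu_min_lt PP r0 rs sr).
move: pp ll; rewrite le_eqVlt => /predU1P[<-|pp] ll.
  by rewrite (risk_fin_le _ _ FL).
by rewrite risk_fin_le_gt //; apply: XF; exact: (mu_min_lt PP r0 rs sr).
Qed.

Lemma risk_attained X : [\/ X = L, X = bias_limit%:E
    | exists2 m, a < m & X = (risk_of_mu m)%:E] ->
  exists2 l, (lmin%:E <= l)%E & Rk l phi%:E = X.
Proof.
case=> [->|->|[m am ->]].
- by exists lmin%:E => //; exact: risk_lmin.
- by exists +oo%E; rewrite ?leey // /risk risk_fin_y.
- exists (lam s phi m)%:E; last exact: risk_lam.
  by rewrite lee_fin ltW //; have [] := mu_lam PP r0 rs sr phi0 am.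
Qed.

Lemma risk_lmin_psi m : 1 <= phi -> a < m ->
  exists2 psi, phi <= psi & Rk lmin%:E psi%:E = (risk_of_mu m)%:E.
Proof.
move=> phi1 am; have rm := lt_trans ra am.
have [_ d20] := dof0 r0 rs sr.
(* [dof2 s 0 = 1], so [a < 0] would give [phi * dof2 s a > phi >= 1]. *)
have a0 : 0 <= a.
  rewrite leNgt; apply/negP => /(dof2_lt r0 rs sr ra); rewrite d20 => h.
  have : phi * dof2 s a <= 1 by rewrite -phia.
  by apply/negP; rewrite -ltNge (le_lt_trans phi1) // -[ltLHS]mulr1 ltr_pM2l.
have m0 : 0 < m := le_lt_trans a0 am.
have mh0 : 0 < m * dof1 s m by rewrite mulr_gt0 // (dof1_gt0 r0 rs sr).
pose psi := (m - lmin) / (m * dof1 s m).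
have lamE : lam s psi m = lmin.
  by rewrite /lam /psi divfK ?gt_eqF // subKr.
have pp : phi < psi.
  rewrite ltr_pdivlMr //; have [+ _] := mu_lam PP r0 rs sr phi0 am.
  by rewrite /lam ltrBrDr -ltrBrDl.
have psi0 := lt_trans phi0 pp.
exists psi; rewrite ?ltW // -lamE risk_lam //.
(* Otherwise [lam psi] would decrease strictly on [a, m], while
   [lam psi m = lmin] already dominates [lam psi a]. *)
rewrite ltNge; apply/negP => mm.
have [ra' pa'] := mu_min_spec PP r0 rs sr psi0.
have : lam s psi m < lam s psi a.
  apply: (lam_decreasing r0 rs sr) => //; rewrite pa' ler_pM2l //.
  by move: mm; rewrite le_eqVlt => /predU1P[->//|h]; rewrite ltW // (dof2_lt r0 rs sr).
(* [lmin] is [lam phi a], and raising [phi] to [psi] cannot increase it because [a >= 0]. *)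
apply/negP; rewrite -leNgt lamE (lambda_min_lam PP r0 rs sr phi0) -/a /lam.
rewrite lerD2l lerN2 ler_wpM2r ?(ltW pp) // mulr_ge0 //.
exact/ltW/(dof1_gt0 r0 rs sr).
Qed.

(** * The case [phi < 1], [beta0 = beta]: comparison of negative [mu] with [mu = 0] *)

Section Underparametrized.
Hypotheses (phi1 : phi < 1) (betaE : beta0 = beta).

Lemma mu_min_lt0 : a < 0.
Proof.
have [_ d20] := dof0 r0 rs sr.
rewrite ltNge; apply/negP; rewrite le_eqVlt => /predU1P[a0|a0].
  by have := phi1; rewrite phia -a0 d20 mulr1 ltxx.
have := dof2_lt r0 rs sr _ a0; rewrite d20 oppr_lt0 => /(_ r0) h.
have : phi * dof2 s a < 1 by rewrite -[ltRHS]mulr1 ltr_pM // ltW // (dof2_gt0 r0 rs sr).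
by rewrite -phia ltxx.
Qed.

Lemma risk_0_phi : Rk 0%E phi%:E = (risk_of_mu 0)%:E.
Proof. by have := risk_lam phi0 mu_min_lt0; rewrite lam_0. Qed.

Lemma risk_0_psi m : 0 < m ->
  exists2 psi, phi <= psi & Rk 0%E psi%:E = (risk_of_mu m)%:E.
Proof.
move=> m0; have rm : - r < m by apply: lt_trans m0; rewrite oppr_lt0.
have [d10 _] := dof0 r0 rs sr.
have h0 := dof1_gt0 r0 rs sr rm.
(* The solution of [lam psi m = 0]. It exceeds [1], hence [phi], because [dof1] decreases from its
   value [1] at [0]. *)
pose psi := (dof1 s m)^-1.
have psi1 : 1 < psi.
  rewrite invf_gt1 // -d10; by apply: (dof1_lt r0 rs sr) => //; rewrite oppr_lt0.
have psi0 : 0 < psi by rewrite invr_gt0.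
have lamE : lam s psi m = 0.
  by rewrite /lam /psi mulrCA mulVf ?mulr1 ?subrr // gt_eqF.
exists psi; first by rewrite ltW // (lt_trans phi1).
have [ra' pa'] := mu_min_spec PP r0 rs sr psi0.
suff am : mu_min Sigma psi < m by have := risk_lam psi0 am; rewrite lamE.
rewrite ltNge; apply/negP => mm.
have : 1 <= psi * dof2 s m.
  rewrite pa' ler_pM2l //; move: mm; rewrite le_eqVlt => /predU1P[->//|h].
  by rewrite ltW // (dof2_lt r0 rs sr).
apply/negP; rewrite -ltNge /psi mulrC ltr_pdivrMr // mul1r.
exact: (dof2_lt_dof1 r0 rs sr).
Qed.

(** With [beta0 = beta] the terms in [beta0 - beta] vanish. What remains above [sigma02] is a
    positive definite form at a vector that is zero for [m = 0]. *)
Let bias_eq m : - r < m -> bias m =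
  bilin (m *: (resolvent Sigma m *m beta)) Sigma0 (m *: (resolvent Sigma m *m beta))
  + sigma02.
Proof.
move=> rm; rewrite biasE // /k betaE subrr.
have -> M : bilin beta M 0 = 0 by rewrite /bilin mulmx0 mxE.
have -> : bilin 0 Sigma0 0 = 0 by rewrite /bilin mulmx0 mxE.
rewrite mulr0 addr0 add0r bilin_mul [in X in bilin X _ _]resolvent_spectral //.
rewrite trmx_spectral_fun -resolvent_spectral // /bilin !linearZ /= -!scalemxAl !mxE.
by ring.
Qed.

Let bias_ge m : - r < m -> sigma02 <= bias m.
Proof.
move=> rm; rewrite bias_eq // lerDr; set u := m *: _.
have [->|uN0] := eqVneq u 0; first by rewrite /bilin mulmx0 mxE.
exact/ltW/bilin_gt0.
Qed.

Let bias_gt m : - r < m -> m != 0 -> beta != 0 -> sigma02 < bias m.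
Proof.
move=> rm mN0 bN0; rewrite bias_eq // ltrDr; apply: bilin_gt0 => //.
rewrite scaler_eq0 negb_or mN0 /=; apply: contra bN0 => /eqP Gb.
apply/eqP; rewrite -[beta]mul1mx -(mulmx1C PP) -mulmxA.
suff -> : P *m beta = 0 by rewrite mulmx0.
apply/colP => i; rewrite [RHS]mxE; apply/eqP.
have : (P *m (resolvent Sigma m *m beta)) i 0 = 0 by rewrite Gb mulmx0 mxE.
rewrite resolvent_spectral // spectral_fun_apply // => /eqP.
by rewrite mulf_eq0 invr_eq0 gt_eqF // (shift_gt0 rs).
Qed.

Let risk_of_mu0 :
  risk_of_mu 0 = sigma02 + vfun s (fun i => M0 i i) phi 0 * sigma2.
Proof.
rewrite /risk_of_mu /rfun bias_eq ?oppr_lt0 // scale0r.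
by rewrite /bilin mulmx0 [in LHS]mxE add0r expr2 !mul0r add0r.
Qed.

Lemma risk_neg m : a < m -> m < 0 -> risk_of_mu 0 <= risk_of_mu m.
Proof.
move=> am m0; have rm := lt_trans ra am; rewrite risk_of_mu0.
have v0 := vfun_gt0 r0 rs sr t0 phi0 ra phia am.
have vv := vfun_lt r0 rs sr t0 phi0 ra phia am m0.
have q0 := qfun_ge0 r0 rs b rm.
apply: lerD; first exact: bias_ge.
apply: (@le_trans _ _ (vfun s (fun i => M0 i i) phi m * sigma2)).
  by rewrite ler_wpM2r // ltW.
by rewrite ler_pM2l // lerDr mulr_ge0 // sqr_ge0.
Qed.

(** Strictness comes from the bias when [beta] is nonzero, and otherwise from [sigma2] times the
    strictly decreasing [vfun]. *)
Lemma risk_neg_lt m : beta <> 0 \/ sigma2 <> 0 -> a < m -> m < 0 ->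
  risk_of_mu 0 < risk_of_mu m.
Proof.
move=> nz am m0; have rm := lt_trans ra am; rewrite risk_of_mu0.
have v0 := vfun_gt0 r0 rs sr t0 phi0 ra phia am.
have vv := vfun_lt r0 rs sr t0 phi0 ra phia am m0.
have q0 := qfun_ge0 r0 rs b rm.
have vle : vfun s (fun i => M0 i i) phi m * sigma2 <=
    vfun s (fun i => M0 i i) phi m * (m ^+ 2 * qfun s b m + sigma2).
  by rewrite ler_pM2l // lerDr mulr_ge0 // sqr_ge0.
case: nz => [/eqP bN0|/eqP sN0].
  apply: ltr_leD; first by apply: bias_gt; rewrite ?lt_eqF.
  by apply: le_trans vle; rewrite ler_wpM2r // ltW.
apply: ler_ltD; first exact: bias_ge.
by apply: lt_le_trans vle; rewrite ltr_pM2r // lt_def sN0.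
Qed.

Lemma risk_right_ge : ((risk_of_mu 0)%:E <= L)%E.
Proof.
rewrite -(cvg_lim _ FL) //; apply: lime_ge; first by apply/cvg_ex; exists L.
near=> m; rewrite lee_fin; apply: risk_neg; near: m.
  exact: nbhs_right_gt.
exact: nbhs_right_lt mu_min_lt0.
Unshelve. all: by end_near. Qed.

(** Passing to the limit in [risk_neg_lt] would lose strictness. Instead, [a != 0] makes the
    coefficient of [vfun] positive at [a], so that [L] is [+oo]. *)
Lemma risk_right_gt : beta <> 0 \/ sigma2 <> 0 -> ((risk_of_mu 0)%:E < L)%E.
Proof.
move=> nz; suff -> : L = +oo%E by rewrite ltry.
apply: (cvg_unique _ FL) => //.
apply: (rfun_right_infty r0 rs sr t0 phi0 ra phia bias_cvg).
have q0 := qfun_ge0 r0 rs b ra.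
case: nz => [/eqP bN0|/eqP sN0]; last first.
  by apply: ltr_wpDl; [rewrite mulr_ge0 // sqr_ge0|rewrite lt_def sN0].
apply: ltr_pwDl => //; apply: mulr_gt0.
  by rewrite lt_def sqr_ge0 sqrf_eq0 lt_eqF // mu_min_lt0.
rewrite lt_def q0 andbT.
apply: contra bN0; rewrite psumr_eq0; last first.
  move=> i _; rewrite mulr_ge0 ?sqr_ge0 // divr_ge0 ?exprn_ge0 ?ltW //.
    exact: lt_le_trans r0 (rs i).
  exact: (shift_gt0 rs).
move=> /allP h; rewrite -[beta]mul1mx -(mulmx1C PP) -mulmxA.
suff -> : P *m beta = 0 by rewrite mulmx0.
apply/colP => i; rewrite [RHS]mxE; apply/eqP.
have := h i (mem_index_enum i); rewrite /= mulf_eq0 sqrf_eq0 => /orP[//|].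
rewrite gt_eqF // divr_gt0 ?exprn_gt0 ?(shift_gt0 rs) //.
exact: (lt_le_trans r0).
Qed.

End Underparametrized.

End Values.
End RiskLink.

(** A single [Rss] serves as the value of all the minima. The condition [beta <> 0 \/ sigma2 <> 0]
    excludes a degenerate case: if [beta0 = beta = 0] and [sigma2 = 0], the risk is constantly
    [sigma02], and for [phi < 1] negative [lambda] are optimal too. *)
Theorem theorem6 (R : realType) (p : nat) (hp : (0 < p)%N)
  (Sigma Sigma0 : 'M[R]_p) (beta beta0 : 'cV[R]_p) (sigma2 sigma02 phi : R)
  (hSsym : symmetric_mx Sigma) (hS0sym : symmetric_mx Sigma0)
  (hSeig : eigenvalues_bounded Sigma) (hS0eig : eigenvalues_bounded Sigma0)
  (hsigma2 : 0 <= sigma2) (hsigma02 : 0 <= sigma02) (hphi : 0 < phi) :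
  let Rk : \bar R -> \bar R -> \bar R :=
    risk Sigma Sigma0 beta beta0 sigma2 sigma02 phi in
  let lmin : \bar R := (lambda_min Sigma phi)%:E in
  let optimal (lstar : \bar R) : Prop :=
    is_argmin (fun l => Rk l phi%:E) [set l | (lmin <= l)%E] lstar in
  exists Rss : \bar R,
    is_min [set Rk ls.1 ls.2 | ls in [set ls : \bar R * \bar R |
       [/\ (phi%:E <= ls.2)%E, (lmin <= ls.1)%E & risk_dom Sigma ls.1 ls.2]]]
      Rss
    /\ (phi < 1 -> beta0 = beta ->
         (forall lstar : \bar R, beta <> 0 \/ sigma2 <> 0 ->
            optimal lstar -> (0 <= lstar)%E)
         /\ is_min [set Rk l phi%:E | l in [set l | (0 <= l)%E]] Rss
         /\ is_min [set Rk 0%E psi | psi in [set psi | (phi%:E <= psi)%E]] Rss)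
    /\ (1 <= phi ->
         (forall lstar : \bar R, optimal lstar -> (lmin <= lstar)%E)
         /\ is_min [set Rk l phi%:E | l in [set l | (lmin <= l)%E]] Rss
         /\ is_min [set Rk lmin psi | psi in [set psi | (phi%:E <= psi)%E]]
              Rss).
Proof.
have [P [d [PP SE]]] := spectral_decomposition hSsym.
move: hSeig; rewrite {}SE => -[c [C [c0 ev]]] Rk lmin optimal.
have [rs sr] := r_min_spectral d hp PP.
have r0 : 0 < r_min (spectral_fun P d id).
  have [i <-] := sr; apply: (lt_le_trans c0).
  have /ev/andP[] // : eigenvalue (spectral_fun P d id) (d 0 i).
  by rewrite eigenvalue_spectral //; apply/existsP; exists i.
have [L FL] :=
  risk_of_mu_right PP r0 rs sr beta beta0 sigma02 hS0sym hS0eig hsigma2 hphi.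
pose F := risk_of_mu P d Sigma0 beta beta0 sigma2 sigma02 phi.
pose K := bias_limit P Sigma0 beta beta0 sigma02.
have Fc x (ax : mu_min (spectral_fun P d id) phi < x) : F m @[m --> x] --> F x.
  exact: (risk_of_mu_cvg PP r0 rs sr hphi ax).
have Fy : (F m)%:E @[m --> +oo] --> K%:E.
  apply: cvg_EFin; first exact: nearW.
  exact: (risk_of_mu_cvgy r0 rs sigma2 phi).
have [X [XV XL XK XF]] := min_open_ray Fc FL Fy.
have Xle l psi : l != -oo%E -> (phi%:E <= psi)%E -> (X <= Rk l psi)%E.
  exact: (risk_values_ge PP r0 rs sr hphi FL XL XK XF).
have lN l x : (x%:E <= l)%E -> l != -oo%E by case: l.
have Ky l : l != -oo%E -> Rk l +oo%E = K%:E by exact: (risk_psi_y PP r0 rs sr).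
have yK : Rk +oo%E phi%:E = K%:E by exact: (risk_fin_y PP r0 rs sr).
have lminN : lmin != -oo%E by [].
have [l0 l0min l0X] := risk_attained PP r0 rs sr hphi FL XV.
exists X; split.
  split.
    (* At [psi = phi] the condition [risk_dom] reduces to [lmin <= l0]. *)
    by exists (l0, phi%:E) => //=; split => // psi [<-].
  by move=> _ [[l psi] /= [pp ll _] <-]; apply: Xle pp; exact: lN ll.
split=> [phi1 betaE|phi1].
  have a0 := mu_min_lt0 PP r0 rs sr hphi phi1.
  have F0 : Rk 0%E phi%:E = (F 0)%:E by exact: (risk_0_phi PP r0 rs sr).
  split=> [lstar nz [lminl opt]|].
    rewrite leNgt; apply/negP => l0'.
    have lmin0 : (lmin <= 0)%E by apply: le_trans lminl (ltW l0').
    have : (Rk lstar phi%:E <= (F 0)%:E)%E by rewrite -F0; exact: opt.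
    apply/negP; rewrite -ltNge.
    case: lstar lminl l0' {opt} => // l ll l_lt0.
    have {}ll : lambda_min (spectral_fun P d id) phi <= l by rewrite -lee_fin.
    move: ll; rewrite le_eqVlt => /predU1P[<-|ll].
      rewrite /Rk (risk_lmin PP r0 rs sr hphi FL).
      exact: (risk_right_gt PP r0 rs sr hS0sym hS0eig hsigma2 hphi FL phi1 nz).
    have [am ml] := mu_spec PP r0 rs sr hphi ll.
    rewrite lte_fin in l_lt0.
    have m0 : mu (spectral_fun P d id) l phi < 0 by rewrite (mu_lt PP r0 rs sr) // lam_0.
    rewrite -[l]ml /Rk (risk_lam PP r0 rs sr) // lte_fin.
    exact: (risk_neg_lt PP r0 rs sr).
  (* The minimum is reached at some [mu] in [[0, +oo]]: if it is reached at a negative [mu] or at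
     the left end, the value at [0] is no larger. *)
  have XV0 : X = K%:E \/ exists2 m, 0 <= m & X = (F m)%:E.
    have F0X : ((F 0)%:E <= X)%E -> X = (F 0)%:E.
      by move=> h; apply/le_anti; rewrite h -F0 Xle.
    case: XV => [XE|->|[m am XE]].
    - right; exists 0 => //; apply: F0X; rewrite XE.
      exact: (risk_right_ge PP r0 rs sr hS0sym hS0eig hsigma2 hphi FL phi1 betaE).
    - by left.
    - have [m0|m0] := leP 0 m; first by right; exists m.
      right; exists 0 => //; apply: F0X; rewrite XE lee_fin.
      exact: (risk_neg PP r0 rs sr).
  split; split.
  - case: XV0 => [->|[m m0 ->]]; first by exists +oo%E; rewrite //= leey.
    have am := lt_le_trans a0 m0.
    (* [lam phi] increases and vanishes at [0], so [m >= 0] corresponds to [lambda >= 0]. *)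
    exists (lam (fun i => d 0 i) phi m)%:E; last exact: (risk_lam PP r0 rs sr).
    rewrite /= lee_fin -(lam_0 (fun i => d 0 i) phi).
    move: m0; rewrite le_eqVlt => /predU1P[->//|m0].
    by rewrite ltW // (lam_homo PP r0 rs sr) // ltW.
  - by move=> _ [l l_ge0 <-]; apply: Xle => //; exact: lN l_ge0.
  - case: XV0 => [->|[m + ->]].
      by exists +oo%E; [rewrite /= leey|exact: Ky].
    rewrite le_eqVlt => /predU1P[<-|m0].
      by exists phi%:E; [exact: lexx|exact: F0].
    have [psi pp psiE] :=
      risk_0_psi PP r0 rs sr Sigma0 beta beta0 sigma2 sigma02 phi1 m0.
    by exists psi%:E.
  - by move=> _ [psi pp <-]; exact: Xle.
split; first by move=> lstar [].
split; split.
- by exists l0.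
- by move=> _ [l ll <-]; apply: Xle => //; exact: lN ll.
- case: XV => [->|->|[m am ->]].
  + by exists phi%:E => //=; exact: (risk_lmin PP r0 rs sr).
  + by exists +oo%E; [rewrite /= leey|exact: Ky].
  + have [psi pp psiE] := risk_lmin_psi PP r0 rs sr Sigma0 beta beta0 sigma2 sigma02 hphi phi1 am.
    by exists psi%:E.
- by move=> _ [psi pp <-]; exact: Xle.
Qed.
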